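(* Let $L=\hat\beta$ be the closure of a braid $\beta$ with three strands, defined by the word $w=\sigma_1^{a_1}\sigma_2^{a_2}\cdots\sigma_1^{a_{2t-1}}\sigma_2^{a_{2t}}$ where all the exponents are nonzero. Assume the following: 1. No exponent $a_i$ is equal to $1$. 2. There exists an exponent $a_j>2$ cyclically surrounded by positive ones. 3. Any negative exponent is cyclically surrounded by positive ones. Then the Khovanov homology of $L$ has at least $$\left\lfloor\frac{a_{i_1}}{2}\right\rfloor\cdots\left\lfloor\frac{a_{i_r}}{2}\right\rfloor-1$$ different torsion elements, where $a_{i_1},\dots,a_{i_r}$ are the positive exponents cyclically surrounded by positive exponents.
   Context: Khovanov homology is the integral (bigraded) Khovanov homology $\bigoplus_{h,q}Kh^{h,q}(L)$; the torsion elements in question are of order two. $\sigma_1,\sigma_2$ are the standard generators of the 3-strand braid group, with the convention that the crossings of $\sigma_i$ are positive crossings when all strands are oriented in the same direction. An exponent $a_i$ is cyclically surrounded by positive ones if $a_{i-1}>0$ and $a_{i+1}>0$, with indices taken modulo $2t$. *)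

(* Defs.v *)
From HB Require Import structures.
From mathcomp Require Import all_boot all_order all_algebra.
From mathcomp Require Import boolp.

Set Implicit Arguments.
Unset Strict Implicit.
Unset Printing Implicit Defensive.

Import Order.TTheory GRing.Theory Num.Theory.
Local Open Scope ring_scope.

Section DirectSum.
Variables (I : finType) (V : I -> zmodType).

Definition dsum : Type := {dffun forall i : I, V i}.
HB.instance Definition _ := Choice.on dsum.

Definition dsum0 : dsum := [ffun i : I => 0 : V i].
Definition dsum_opp (x : dsum) : dsum := [ffun i : I => - x i : V i].
Definition dsum_add (x y : dsum) : dsum := [ffun i : I => x i + y i : V i].

Fact dsum_addA : associative dsum_add.
Proof. by move=> x y z; apply/ffunP=> i; rewrite !ffunE addrA. Qed.
Fact dsum_addC : commutative dsum_add.
Proof. by move=> x y; apply/ffunP=> i; rewrite !ffunE addrC. Qed.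
Fact dsum_add0 : left_id dsum0 dsum_add.
Proof. by move=> x; apply/ffunP=> i; rewrite !ffunE add0r. Qed.
Fact dsum_addN : left_inverse dsum0 dsum_opp dsum_add.
Proof. by move=> x; apply/ffunP=> i; rewrite !ffunE addNr. Qed.

HB.instance Definition _ :=
  GRing.isZmodule.Build dsum dsum_addA dsum_addC dsum_add0 dsum_addN.
End DirectSum.

(* The letter (i, true) is sigma_(i+1) and (i, false) is its inverse, in the
   braid group on b.+1 strands. *)
Definition braid_word (b : nat) := seq ('I_b * bool).

Section Khovanov.
Variables (b : nat) (w : braid_word b).

Definition crossing := 'I_(size w).
Definition gen (k : crossing) : 'I_b := (tnth (in_tuple w) k).1.
Definition positive (k : crossing) : bool := (tnth (in_tuple w) k).2.

(* All strands are oriented in the direction of the braid. *)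
Definition n_plus : nat := #|[pred k | positive k]|.
Definition n_minus : nat := #|[pred k | ~~ positive k]|.

(* The braid is cut by the horizontal levels 0, ..., size w, the k-th crossing
   lying between levels k and k.+1; (l, p) is the point at level l on the p-th
   vertical strand line. *)
Definition point : finType := ('I_(size w).+1 * 'I_b.+1)%type.

Definition bottom_left (k : crossing) : point :=
  (inord k, widen_ord (leqnSn b) (gen k)).
Definition top_right (k : crossing) : point := (inord k.+1, lift ord0 (gen k)).

(* s k is the smoothing (false : 0, true : 1) of the k-th crossing. *)
Definition state := {ffun crossing -> bool}.

(* The 0-smoothing of a positive crossing and the 1-smoothing of a negative one
   respect the orientation, i.e. consist of two vertical arcs. *)
Definition vertical (s : state) (k : crossing) : bool := positive k (+) s k.

Definition half_arc (s : state) : rel point := fun x y =>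
  [&& (x.1 == size w :> nat), (y.1 == 0 :> nat) & x.2 == y.2]
  || [exists k : crossing,
       [&& (x.1 == k :> nat), (y.1 == k.+1 :> nat), x.2 == y.2 &
           vertical s k || ((x.2 : nat) \notin [:: (gen k : nat); (gen k).+1])]
       || [&& ~~ vertical s k, x.1 == y.1,
              ((x.1 : nat) \in [:: (k : nat); k.+1]),
              (x.2 == gen k :> nat) & (y.2 == (gen k).+1 :> nat)]].

(* The circles of the smoothed diagram of the closure are the connected
   components of this graph. *)
Definition arc (s : state) : rel point :=
  fun x y => half_arc s x y || half_arc s y x.

(* A labelling of the circles by v_+ (true) and v_- (false), encoded as a
   function on the points that is constant along each circle. *)
Definition labelling (s : state) (f : {ffun point -> bool}) : bool :=
  [forall x, forall y, connect (arc s) x y ==> (f x == f y)].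

Definition enhanced : finType :=
  {x : state * {ffun point -> bool} | labelling x.1 x.2}.
Definition st (x : enhanced) : state := (val x).1.
Definition lab (x : enhanced) : {ffun point -> bool} := (val x).2.

Definition height (s : state) : nat := #|[pred k | s k]|.

Definition label_degree (x : enhanced) : int :=
  (n_comp (arc (st x)) [pred p | lab x p])%:Z
  - (n_comp (arc (st x)) [pred p | ~~ lab x p])%:Z.

Definition bidegree (x : enhanced) : int * int :=
  ((height (st x))%:Z - n_minus%:Z,
   label_degree x + (height (st x))%:Z + n_plus%:Z - (2 * n_minus)%:Z).

(* m : v+v+ |-> v+, v+v- and v-v+ |-> v-, v-v- |-> 0. *)
Definition merge_coef (u v u' : bool) : bool := (u || v) && (u' == u && v).
(* Delta : v+ |-> v+v- + v-v+, v- |-> v-v-. *)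
Definition split_coef (u u' v' : bool) : bool :=
  if u then u' (+) v' else ~~ u' && ~~ v'.

Definition far_from (s : state) (k : crossing) : pred point := fun p =>
  ~~ connect (arc s) p (bottom_left k) && ~~ connect (arc s) p (top_right k).

(* y occurs in the image of x under the map of the edge changing crossing k.
   Opposite corners of a crossing lie on the two different arcs of each of its
   smoothings, so the 0-smoothing has one or two circles through the crossing
   according to whether these corners are connected. *)
Definition edge (k : crossing) (x y : enhanced) : bool :=
  [&& ~~ st x k,
      st y == [ffun j => if j == k then true else st x j],
      [forall p, far_from (st x) k p ==> (lab y p == lab x p)] &
      if connect (arc (st x)) (bottom_left k) (top_right k)
      then split_coef (lab x (bottom_left k))
             (lab y (bottom_left k)) (lab y (top_right k))
      else merge_coef (lab x (bottom_left k)) (lab x (top_right k))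
             (lab y (bottom_left k))].

Definition incidence (x y : enhanced) : int :=
  \sum_(k | edge k x y) (-1) ^+ #|[pred j : crossing | (j < k)%N && st x j]|.

Definition chain : zmodType := {ffun enhanced -> int}.

Definition diff (c : chain) : chain :=
  [ffun y => \sum_x c x * incidence x y].

Definition homogeneous (hq : int * int) : {pred chain} :=
  fun c => [forall x, (c x != 0) ==> (bidegree x == hq)].

Fact diff_is_zmod_morphism : zmod_morphism diff.
Proof.
move=> c c'; apply/ffunP=> y; rewrite !ffunE -sumrB.
by apply: eq_bigr => x _; rewrite !ffunE mulrBl.
Qed.
HB.instance Definition _ :=
  GRing.isZmodMorphism.Build chain chain diff diff_is_zmod_morphism.

Fact homogeneous_zmod_closed hq : zmod_closed (homogeneous hq).
Proof.
split=> [|c c' /forallP hc /forallP hc'].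
  by apply/forallP=> x; rewrite ffunE eqxx.
apply/forallP=> x; apply/implyP; apply: contraR => nx.
have := hc x; have := hc' x; rewrite (negPf nx) !implybF !negbK.
by rewrite !ffunE => /eqP-> /eqP->; rewrite subr0.
Qed.

Section Bidegree.
Variable hq : int * int.

Definition is_cocycle : {pred chain} :=
  fun c => homogeneous hq c && (diff c == 0).

Fact is_cocycle_zmod_closed : zmod_closed is_cocycle.
Proof.
have [h0 hB] := homogeneous_zmod_closed hq.
split=> [|c c' /andP[hc /eqP dc] /andP[hc' /eqP dc']].
  by apply/andP; rewrite raddf0.
by apply/andP; split; [exact: hB | rewrite raddfB /= dc dc' subr0].
Qed.
HB.instance Definition _ :=
  GRing.isZmodClosed.Build chain is_cocycle is_cocycle_zmod_closed.

Record cocycle := Cocycle { cocycle_val :> chain; _ : is_cocycle cocycle_val }.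
HB.instance Definition _ := [isSub for cocycle_val].
HB.instance Definition _ := [Choice of cocycle by <:].
HB.instance Definition _ := [SubChoice_isSubZmodule of cocycle by <:].

Definition is_coboundary : {pred cocycle} := fun z =>
  `[< exists2 c : chain, homogeneous (hq.1 - 1, hq.2) c & diff c = z >].

Fact is_coboundary_zmod_closed : zmod_closed is_coboundary.
Proof.
have [h0 hB] := homogeneous_zmod_closed (hq.1 - 1, hq.2).
split=> [|z z' /asboolP[c hc dc] /asboolP[c' hc' dc']]; apply/asboolP.
  by exists 0; rewrite ?raddf0.
by exists (c - c'); [exact: hB | rewrite raddfB /= dc dc'].
Qed.
HB.instance Definition _ :=
  GRing.isZmodClosed.Build cocycle is_coboundary is_coboundary_zmod_closed.

Definition Kh_at : zmodType := {ideal_quot is_coboundary}.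
End Bidegree.

(* The direct sum of all the Kh^(h,q): the chain groups, hence the Kh^(h,q),
   vanish outside the finitely many bidegrees of the enhanced states. *)
Definition Kh : zmodType :=
  dsum (fun hq : seq_sub (codom bidegree) => Kh_at (val hq)).
End Khovanov.

Definition order_two (V : zmodType) (x : V) : bool := (x != 0) && (x *+ 2 == 0).

(* Exponents are numbered from 0: a i is the mathematical a_(i+1), so the even
   indices carry sigma_1 and the odd ones sigma_2. *)
Definition alternating_word (n : nat) (a : 'I_n -> int) : braid_word 2 :=
  flatten [seq nseq `|a i|%N (if odd i then ord_max else ord0, 0 < a i)
          | i <- enum 'I_n].

Definition surrounded (n : nat) (a : 'I_n -> int) (i : 'I_n) : bool :=
  (0 < a (ord_pred i)) && (0 < a (ordS i)).

(* Main.v *)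
(* In a positive twist region a_i surrounded by positive ones, with all other
   crossings smoothed to 1, let c_j be the sum of the all-v_+ states with
     exactly
   j ones in the region.  The differential of c_j only splits circles, and its
   coefficients telescope along the region: the contributions of the two ends
   cancel for odd j and, as both ends lie on the same circle X, add up for even
   j > 0.  Hence d c_j = 2 z_(j+1), where z_(j+1) is up to sign the sum of the
   states with j + 1 ones whose only v_- is on X; multiplication by v_- on X
   turns d c_(j+1) = 0 into d z_(j+1) = 0.
     If every edge of the cube arriving at a state s is a split, then the sum of
   the coefficients of the enhanced states over s with exactly one v_- is even
     on
   coboundaries: both terms of Delta(v_+) contribute and Delta(v_-) does not.
   The states of z_(j+1) have this property for even j with 2 <= j <= a_i - 2,
     so
   that these classes, for all such i and j, are independent of order two; their
   number is the sum of the floor(a_i/2) - 1, and 2^(m-1) >= m. *)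
From mathcomp Require Import all_boot all_order all_algebra perm.
From mathcomp Require Import boolp zify ring.
Require Import Defs.

Set Implicit Arguments.
Unset Strict Implicit.
Unset Printing Implicit Defensive.

Import Order.TTheory GRing.Theory Num.Theory.
Local Open Scope ring_scope.

(** * Circles of a smoothing as orbits of a permutation *)

Section Smoothing.
Local Open Scope nat_scope.
Variables (b : nat) (w : braid_word b).
Implicit Types (s : state w) (k : crossing w) (x y : point w).

Definition pt (l p : nat) : point w := (inord l, inord p).

Definition flips s s' k := s' k = ~~ s k /\ forall j, j != k -> s' j = s j.

Definition touches k (p : nat) := p \in [:: (gen k : nat); (gen k).+1].
Definition other k (p : nat) : nat :=
  if p == gen k then (gen k).+1 else gen k.

Lemma touches_ltn k p : touches k p -> p < b.+1.
Proof. by rewrite /touches !inE; have := ltn_ord (gen k); lia. Qed.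

Lemma other_gen k : other k (gen k) = (gen k).+1.
Proof. by rewrite /other eqxx. Qed.

Lemma otherS k : other k (gen k).+1 = gen k.
Proof. by rewrite /other; case: eqP => //; lia. Qed.

Lemma odd_other k p : touches k p -> odd (other k p) = ~~ odd p.
Proof.
rewrite /touches !inE => /orP[] /eqP ->; first by rewrite other_gen.
by rewrite otherS negbK.
Qed.

Lemma touches_other k p : touches k p -> touches k (other k p).
Proof.
by rewrite /touches /other !inE => _; case: ifP; rewrite eqxx ?orbT.
Qed.

Lemma otherK k p : touches k p -> other k (other k p) = p.
Proof.
by rewrite /touches !inE => /orP[] /eqP->; rewrite ?(other_gen, otherS).
Qed.

(* The two half-edges at a point [(l, p)] lead through the crossing above and
   through the crossing below level [l]. *)
Definition up s x : point w :=
  if insub (x.1 : nat) is Some k then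
    if vertical s k || ~~ touches k x.2 then (inord k.+1, x.2)
    else (x.1, inord (other k x.2))
  else (ord0, x.2).

Definition dn s x : point w :=
  if x.1 == 0 :> nat then (ord_max, x.2) else
  if insub (x.1.-1 : nat) is Some k then
    if vertical s k || ~~ touches k x.2 then (inord k, x.2)
    else (x.1, inord (other k x.2))
  else x.

Variant up_spec s x : point w -> Type :=
  | UpWrap of x.1 = size w :> nat : up_spec s x (ord0, x.2)
  | UpVert k of x.1 = k :> nat & vertical s k || ~~ touches k x.2 :
      up_spec s x (inord k.+1, x.2)
  | UpHor k of x.1 = k :> nat & ~~ vertical s k & touches k x.2 :
      up_spec s x (x.1, inord (other k x.2)).

Lemma upP s x : up_spec s x (up s x).
Proof.
rewrite /up; case: insubP => [k _ /esym ek | nlt].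
  case: ifP => [h | /negbT]; first exact: UpVert.
  by rewrite negb_or negbK => /andP[h1 h2]; apply: UpHor ek h1 h2.
by apply: UpWrap; have := ltn_ord x.1; lia.
Qed.

Variant dn_spec s x : point w -> Type :=
  | DnWrap of x.1 = 0 :> nat : dn_spec s x (ord_max, x.2)
  | DnVert k of x.1 = k.+1 :> nat & vertical s k || ~~ touches k x.2 :
      dn_spec s x (inord k, x.2)
  | DnHor k of x.1 = k.+1 :> nat & ~~ vertical s k & touches k x.2 :
      dn_spec s x (x.1, inord (other k x.2)).

Lemma dnP s x : dn_spec s x (dn s x).
Proof.
rewrite /dn; case: eqP => [|/eqP nz]; first exact: DnWrap.
case: insubP => [k _ ek | nlt]; last by have := ltn_ord x.1; lia.
have ek' : x.1 = k.+1 :> nat by rewrite ek; lia.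
case: ifP => [h | /negbT]; first exact: DnVert.
by rewrite negb_or negbK => /andP[h1 h2]; apply: DnHor ek' h1 h2.
Qed.

Lemma up_wrap s x : x.1 = size w :> nat -> up s x = (ord0, x.2).
Proof. by case: upP => // k ->; have := ltn_ord k; lia. Qed.

Lemma up_vert s k x : x.1 = k :> nat -> vertical s k || ~~ touches k x.2 ->
  up s x = (inord k.+1, x.2).
Proof.
move=> ek h; case: upP => [|j|j]; rewrite ek.
- by have := ltn_ord k; lia.
- by move/val_inj=> <-.
- by move/val_inj=> <-; move: h => /orP[-> //|/negPf->].
Qed.

Lemma up_hor s k x : x.1 = k :> nat -> ~~ vertical s k -> touches k x.2 ->
  up s x = (x.1, inord (other k x.2)).
Proof.
move=> ek h1 h2; case: upP => [|j|j]; rewrite ek.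
- by have := ltn_ord k; lia.
- by move/val_inj=> <-; rewrite h2 (negPf h1).
- by move/val_inj=> <-.
Qed.

Lemma dn_wrap s x : x.1 = 0 :> nat -> dn s x = (ord_max, x.2).
Proof. by case: dnP => // k ->. Qed.

Lemma dn_vert s k x : x.1 = k.+1 :> nat -> vertical s k || ~~ touches k x.2 ->
  dn s x = (inord k, x.2).
Proof.
move=> ek h; case: dnP => [|j|j]; rewrite ek => //.
- by move=> [/val_inj <-].
- by move=> [/val_inj <-]; move: h => /orP[-> //|/negPf->].
Qed.

Lemma dn_hor s k x : x.1 = k.+1 :> nat -> ~~ vertical s k -> touches k x.2 ->
  dn s x = (x.1, inord (other k x.2)).
Proof.
move=> ek h1 h2; case: dnP => [|j|j]; rewrite ek => //.
- by move=> [/val_inj <-]; rewrite h2 (negPf h1).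
- by move=> [/val_inj <-].
Qed.

Lemma inord_other k (p : 'I_b.+1) :
  touches k p -> (inord (other k p) : 'I_b.+1) = other k p :> nat.
Proof. by move=> /touches_other/touches_ltn h; rewrite inordK. Qed.

(** A vertical step or a closing arc keeps the column and is undone by going down; a cup joins
    adjacent columns, so it changes the parity and is undone by going up again. The parity tells the
    two cases apart, which makes [flow] invertible. *)
Lemma up_turn s x :
  odd (up s x).2 = odd x.2 /\ dn s (up s x) = x \/
  odd (up s x).2 = ~~ odd x.2 /\ up s (up s x) = x.
Proof.
case: x => l p; case: upP => /= [e|k e h|k e h t].
- by left; rewrite dn_wrap //=; split=> //; congr (_, _); apply: val_inj.
- left; split=> //.
  rewrite (@dn_vert _ k) //= ?inordK ?ltnS //; congr (_, _); apply: val_inj.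
  by rewrite /= inordK // ltnS; apply: ltnW.
- right; rewrite inord_other // odd_other //; split=> //.
  rewrite (@up_hor _ k) //= inord_other ?touches_other // otherK //.
  by rewrite inord_val.
Qed.

Lemma dn_turn s x :
  odd (dn s x).2 = odd x.2 /\ up s (dn s x) = x \/
  odd (dn s x).2 = ~~ odd x.2 /\ dn s (dn s x) = x.
Proof.
case: x => l p; case: dnP => /= [e|k e h|k e h t].
- by left; rewrite up_wrap //=; split=> //; congr (_, _); apply: val_inj.
- left; split=> //.
  rewrite (@up_vert _ k) //= ?inordK //; try by rewrite ltnS; apply: ltnW.
  by congr (_, _); apply: val_inj; rewrite /= inordK ?ltnS.
- right; rewrite inord_other // odd_other //; split=> //.
  rewrite (@dn_hor _ k) //= inord_other ?touches_other // otherK //.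
  by rewrite inord_val.
Qed.

Lemma half_arc_turn s x y :
  half_arc s x y -> [\/ y = up s x, x = up s y, y = dn s x | x = dn s y].
Proof.
case: x y => [l p] [l' p'] /orP[/and3P[/= /eqP e1 /eqP e2 /eqP e3]|].
  by apply: Or41; rewrite up_wrap //= -e3; congr (_, _); apply: val_inj.
move=> /existsP[k /orP[/and4P[/= /eqP e1 /eqP e2 /eqP e3 h]|]].
  apply: Or41; rewrite (@up_vert _ k) //= e3; congr (_, _); apply: val_inj.
  by rewrite /= inordK ?e2 ?ltnS.
move=> /and5P[/= h /eqP e1 lk /eqP e2 /eqP e3].
have t : touches k p by rewrite /touches e2 !inE eqxx.
have e4 : p' = inord (other k p).
  by apply: val_inj; rewrite /= inord_other // e3 /other e2 eqxx.
move: lk; rewrite !inE -e1 e4 => /orP[] /eqP lk.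
  by apply: Or41; rewrite (@up_hor _ k).
by apply: Or43; rewrite (@dn_hor _ k).
Qed.

Lemma arc_sym s : symmetric (arc s).
Proof. by move=> x y; rewrite /arc orbC. Qed.

Lemma connect_arc_sym s : connect_sym (arc s).
Proof. by apply: sym_connect_sym; exact: arc_sym. Qed.

Lemma arc_up s x : arc s x (up s x).
Proof.
case: x => l p; rewrite /arc; case: upP => /= [e|k e h|k e h t].
- by rewrite /half_arc /= e !eqxx.
- apply/orP; left; apply/orP; right; apply/existsP; exists k.
  by rewrite /= e inordK ?ltnS // !eqxx h.
- move: (t); rewrite /touches !inE => /orP[] /eqP ep; apply/orP.
    left; apply/orP; right; apply/existsP; exists k; apply/orP; right.
    by rewrite h /= eqxx inord_other //= ep e other_gen !inE !eqxx.
  right; apply/orP; right; apply/existsP; exists k; apply/orP; right.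
  by rewrite h /= eqxx inord_other //= ep e otherS !inE !eqxx.
Qed.

Lemma arc_dn s x : arc s x (dn s x).
Proof.
case: x => l p; rewrite /arc; case: dnP => /= [e|k e h|k e h t].
- by rewrite /half_arc /= e !eqxx orbT.
- apply/orP; right; apply/orP; right; apply/existsP; exists k.
  by rewrite /= e inordK ?ltnS 1?ltnW // !eqxx h.
- move: (t); rewrite /touches !inE => /orP[] /eqP ep; apply/orP.
    left; apply/orP; right; apply/existsP; exists k; apply/orP; right.
    by rewrite h /= eqxx inord_other //= ep e other_gen !inE !eqxx orbT.
  right; apply/orP; right; apply/existsP; exists k; apply/orP; right.
  by rewrite h /= eqxx inord_other //= ep e otherS !inE !eqxx orbT.
Qed.

(* Orienting the even columns upwards and the odd ones downwards (the other way
   round for [o = true]) makes every smoothing a coherently oriented family of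
   circles, since a cup or cap joins columns of different parities. *)
Definition flow o s x : point w := if odd x.2 (+) o then dn s x else up s x.

Lemma flowK o s : cancel (flow o s) (flow (~~ o) s).
Proof.
move=> x; rewrite /flow; case h: (odd x.2 (+) o).
  have [[-> ->]|[-> ->]] := dn_turn s x; first by rewrite addbN h.
  by rewrite addNb addbN h.
have [[-> ->]|[-> ->]] := up_turn s x; first by rewrite addbN h.
by rewrite addNb addbN h.
Qed.

Definition flow_perm o s : {perm point w} := perm (can_inj (@flowK o s)).

Lemma flow_permE o s x : flow_perm o s x = flow o s x.
Proof. exact: permE. Qed.

(** The two half-edges at a point are traversed by [flow o] and by its inverse [flow (~~ o)], so a
    component of the graph is one cycle of a permutation. *)
Lemma connect_flow o s x y : connect (arc s) x y = fconnect (flow o s) x y.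
Proof.
have nsym : connect_sym (frel (flow o s)).
  by apply: fconnect_sym; exact: can_inj (@flowK o s).
have step z : fconnect (flow o s) z (up s z) && fconnect (flow o s) z (dn s z).
  have c1 : fconnect (flow o s) z (flow o s z) by exact: fconnect1.
  have c2 : fconnect (flow o s) z (flow (~~ o) s z).
    rewrite nsym; set u := flow (~~ o) s z.
    have -> : z = flow o s u by rewrite /u; have := flowK (~~ o) s z;
      rewrite negbK.
    exact: fconnect1.
  by move: c1 c2; rewrite /flow addbN; case: (_ (+) _) => /= -> ->.
apply/idP/idP; apply: connect_sub => {x y} x y.
  have H u v : half_arc s u v -> fconnect (flow o s) u v.
    move=> /half_arc_turn[] ->; have/andP[s1 s2] := step u.
    - by [].
    - by rewrite nsym; have/andP[] := step v.
    - by [].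
    - by rewrite nsym; have/andP[] := step v.
  by case/orP=> /H //; rewrite nsym.
move=> /eqP <-; apply: connect1; rewrite /flow.
by case: ifP => _; [exact: arc_dn | exact: arc_up].
Qed.

Lemma flips_vertical s s' k : flips s s' k ->
  vertical s' k = ~~ vertical s k /\ forall j, j != k ->
    vertical s' j = vertical s j.
Proof.
by move=> [e1 e2]; split=> [|j nj]; rewrite /vertical ?e1 ?addbN ?e2.
Qed.

Lemma bottom_leftE k : (bottom_left k).1 = k :> nat.
Proof. by rewrite /= inordK // ltnS ltnW. Qed.
Lemma top_rightE k : (top_right k).1 = k.+1 :> nat.
Proof. by rewrite /= inordK // ltnS. Qed.

Lemma flips_sym s s' k : flips s s' k -> flips s' s k.
Proof. by move=> [e1 e2]; split=> [|j nj]; rewrite ?e1 ?negbK ?e2. Qed.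

Lemma bl_neq_tr k : bottom_left k != top_right k.
Proof.
by apply/eqP=> /(congr1 (fun z : point w => (z.1 : nat)));
  rewrite bottom_leftE top_rightE; lia.
Qed.

Lemma up_flips s s' k x : flips s s' k ->
  x.1 != k :> nat \/ ~~ touches k x.2 -> up s' x = up s x.
Proof.
move=> /flips_vertical[_ E] h; case: upP => [e|j e v|j e v t].
- by rewrite up_wrap.
- rewrite (@up_vert s j) //; have [ej|nj] := eqVneq j k; last by rewrite -E.
  by case: h => [|nt]; rewrite ?e ej ?eqxx ?nt ?orbT.
- have [ej|nj] := eqVneq j k; first by case: h; rewrite ?e -ej ?eqxx ?t.
  by rewrite (@up_hor s j) // -E.
Qed.

Lemma dn_flips s s' k x : flips s s' k ->
  x.1 != k.+1 :> nat \/ ~~ touches k x.2 -> dn s' x = dn s x.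
Proof.
move=> /flips_vertical[_ E] h; case: dnP => [e|j e v|j e v t].
- by rewrite dn_wrap.
- rewrite (@dn_vert s j) //; have [ej|nj] := eqVneq j k; last by rewrite -E.
  by case: h => [|nt]; rewrite ?e ej ?eqxx ?nt ?orbT.
- have [ej|nj] := eqVneq j k; first by case: h; rewrite ?e -ej ?eqxx ?t.
  by rewrite (@dn_hor s j) // -E.
Qed.

Lemma touches_bl k : touches k (bottom_left k).2.
Proof. by rewrite /touches !inE eqxx. Qed.

Lemma touches_tr k : touches k (top_right k).2.
Proof. by rewrite /touches !inE eqxx orbT. Qed.

(** The two smoothings pair the four corners differently: the corner attached to the bottom left in
    one is attached to the top right in the other. *)
Lemma corners_up_dn s s' k : flips s s' k ->
  up s' (bottom_left k) = dn s (top_right k).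
Proof.
move=> /[dup] fl /flips_vertical[e _].
have [v|h] := boolP (vertical s k).
  rewrite (@up_hor s' k) ?bottom_leftE ?touches_bl ?e ?v //.
  rewrite (@dn_vert s k) ?top_rightE ?v //=; congr (_, _); apply: val_inj.
  by rewrite /= other_gen inordK // !ltnS.
rewrite (@up_vert s' k) ?bottom_leftE ?e ?h //.
rewrite (@dn_hor s k) ?top_rightE ?touches_tr //=; congr (_, _).
by apply: val_inj; rewrite /= otherS inordK // ltnS ltnW.
Qed.

(** With [o = odd (gen k)] the flow runs up in the left column of the crossing and down in the right
    one, so it enters the crossing exactly at these two opposite corners. Changing the smoothing
    swaps their images. *)
Lemma flow_perm_flips s s' k : flips s s' k ->
  flow_perm (odd (gen k)) s' =
  (tperm (bottom_left k) (top_right k) * flow_perm (odd (gen k)) s)%g.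
Proof.
move=> fl; apply/permP=> x; rewrite permM !flow_permE /flow.
case: (tpermP (bottom_left k) (top_right k) x) => [->|->|nbl ntr];
  rewrite ?addbb /= ?addNb ?addbb /=.
- exact: corners_up_dn fl.
- by rewrite (corners_up_dn (flips_sym fl)).
case: x nbl ntr => l p nbl ntr; case: ifP => /= o.
  apply: (dn_flips fl); apply/orP; rewrite -negb_and; apply/andP.
  rewrite /touches !inE => -[/eqP el /orP[] /eqP ep];
    first by rewrite ep addbb in o.
  by case: ntr; congr (_, _); apply: val_inj;
    rewrite ?ep //= inordK ?el // ltnS.
apply: (up_flips fl); apply/orP; rewrite -negb_and; apply/andP.
rewrite /touches !inE => -[/eqP el /orP[] /eqP ep]; last first.
  by rewrite ep /= addNb addbb in o.
by case: nbl; congr (_, _); apply: val_inj;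
  rewrite ?ep //= inordK ?el // ltnS ltnW.
Qed.

Lemma porbit_flow_perm o s x y : (y \in porbit (flow_perm o s) x) = connect
  (arc s) x y.
Proof.
rewrite (connect_flow o); apply/porbitP/idP => [[i ->]|/iter_findex h].
  by rewrite permX (eq_iter (flow_permE o s)); exact: fconnect_iter.
by exists (findex (flow o s) x y); rewrite permX (eq_iter (flow_permE o s)).
Qed.

Lemma n_comp_porbits o s : n_comp (arc s) predT = #|porbits (flow_perm o s)|.
Proof.
have csym := connect_arc_sym s.
pose R : {set point w} := [set x in roots (arc s)].
have -> : porbits (flow_perm o s) = [set porbit (flow_perm o s) x | x in R].
  apply/setP=> A; apply/imsetP/imsetP => -[x xR ->{A}]; last by exists x.
  exists (fingraph.root (arc s) x); first by rewrite inE; exact: roots_root.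
  by apply/eqP; rewrite eq_porbit_mem porbit_flow_perm csym connect_root.
rewrite card_in_imset => [|x y]; first by apply: eq_card => x;
  rewrite !inE andbT.
rewrite !inE => /eqP rx /eqP ry /eqP;
  rewrite eq_porbit_mem porbit_flow_perm csym.
by move=> /(fingraph.rootP csym); rewrite rx ry.
Qed.

(** Composing with a transposition cuts a cycle through both corners into two. The cycle count
    [porbits_mul_tperm] is used from [s] to [s'] and back, which also forces the corners apart in
    [s']. *)
Lemma split_circle s s' k : flips s s' k ->
  connect (arc s) (bottom_left k) (top_right k) ->
  ~~ connect (arc s') (bottom_left k) (top_right k) /\
  n_comp (arc s') predT = (n_comp (arc s) predT).+1.
Proof.
move=> fl c.
have := porbits_mul_tperm (flow_perm (odd (gen k)) s) (bottom_left k)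
  (top_right k).
have := porbits_mul_tperm (flow_perm (odd (gen k)) s') (bottom_left k)
  (top_right k).
rewrite /= -(flow_perm_flips fl) -(flow_perm_flips (flips_sym fl)).
rewrite !porbit_flow_perm -!n_comp_porbits ![connect _ (top_right k)
  _]connect_arc_sym.
by rewrite c bl_neq_tr; case: connect => /=; lia.
Qed.

End Smoothing.

(** * Circles before and after changing one crossing *)

Section Circles.
Local Open Scope nat_scope.
Variables (b : nat) (w : braid_word b).
Implicit Types (s : state w) (k : crossing w) (x y : point w).
Local Notation pt := (pt w).

Lemma ptE (l p : nat) : l < (size w).+1 -> p < b.+1 ->
  (pt l p).1 = l :> nat /\ (pt l p).2 = p :> nat.
Proof. by move=> hl hp; rewrite /= !inordK. Qed.

Lemma pt_val x : x = pt x.1 x.2.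
Proof. by case: x => l p; rewrite /pt /= !inord_val. Qed.

Lemma bottom_left_pt k : bottom_left k = pt k (gen k).
Proof.
by congr (_, _); apply: val_inj; rewrite /= inordK // ltnS ltnW.
Qed.

Lemma top_right_pt k : top_right k = pt k.+1 (gen k).+1.
Proof. by congr (_, _); apply: val_inj; rewrite /= inordK // ltnS. Qed.

Lemma touches_gen k : touches k (gen k).
Proof. by rewrite /touches !inE eqxx. Qed.

Lemma connect_vert s k p : p < b.+1 -> vertical s k || ~~ touches k p ->
  connect (arc s) (pt k p) (pt k.+1 p).
Proof.
move=> hp h; have [e1 e2] := @ptE k p (ltnW (ltn_ord k)) hp.
by have := arc_up s (pt k p); rewrite (@up_vert _ _ _ k) ?e2 // => /connect1.
Qed.

Lemma connect_cup s k : ~~ vertical s k ->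
  connect (arc s) (pt k (gen k)) (pt k (gen k).+1).
Proof.
move=> h; have [e1 e2] := @ptE k (gen k) (ltnW (ltn_ord k)) (ltnW (ltn_ord (gen
  k))).
have := arc_up s (pt k (gen k)).
by rewrite (@up_hor _ _ _ k) ?e2 ?touches_gen // other_gen => /connect1.
Qed.

Lemma connect_cap s k : ~~ vertical s k ->
  connect (arc s) (pt k.+1 (gen k)) (pt k.+1 (gen k).+1).
Proof.
move=> h; have [e1 e2] := @ptE k.+1 (gen k) (ltn_ord k) (ltnW (ltn_ord (gen
  k))).
have := arc_dn s (pt k.+1 (gen k)).
by rewrite (@dn_hor _ _ _ k) ?e2 ?touches_gen // other_gen => /connect1.
Qed.

Lemma connect_wrap s p : p < b.+1 -> connect (arc s) (pt (size w) p) (pt 0 p).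
Proof.
move=> hp; have [e1 e2] := @ptE (size w) p (ltnSn _) hp.
have -> : pt 0 p = up s (pt (size w) p); last exact/connect1/arc_up.
by rewrite up_wrap //; congr (_, _); apply: val_inj; rewrite /= inordK.
Qed.

Definition corner k x := (((x.1 : nat) \in [:: (k : nat);
  k.+1]) && touches k x.2).

(** Each arc of either smoothing has exactly one of the two opposite corners as an end, and every
    other corner is the far end of such an arc. *)
Lemma corner_connect s k x : corner k x ->
  connect (arc s) x (bottom_left k) || connect (arc s) x (top_right k).
Proof.
have csym := connect_arc_sym s.
rewrite bottom_left_pt top_right_pt /corner /touches !inE => cx.
rewrite (pt_val x); move: cx.
case/andP=> /orP[] /eqP -> /orP[] /eqP ->; rewrite ?connect0 ?orbT //.
- have [v|h] := boolP (vertical s k); apply/orP; [right|left].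
    by apply: connect_vert; rewrite ?v ?ltnS.
  by rewrite csym; exact: connect_cup.
- have [v|h] := boolP (vertical s k); apply/orP; [left|right].
    by rewrite csym; apply: connect_vert; rewrite ?v ?ltnS 1?ltnW.
  exact: connect_cap.
Qed.

Lemma arc_turn s x y : arc s x y -> y = up s x \/ y = dn s x.
Proof.
case/orP=> /half_arc_turn[->|->|->|->]; try by [left|right].
- by have [[_ ->]|[_ ->]] := up_turn s y; [right|left].
- by have [[_ ->]|[_ ->]] := dn_turn s y; [left|right].
- by have [[_ ->]|[_ ->]] := up_turn s y; [right|left].
- by have [[_ ->]|[_ ->]] := dn_turn s y; [left|right].
Qed.

Lemma corner_up s k x : x.1 = k :> nat -> touches k x.2 -> corner k (up s x).
Proof.
case: x => l p /= e t; have [v|h] := boolP (vertical s k).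
  by rewrite (@up_vert _ _ _ k) ?v // /corner /= inordK ?ltnS // !inE eqxx orbT.
by rewrite (@up_hor _ _ _ k) // /corner /= inord_other // e !inE eqxx
  touches_other.
Qed.

Lemma corner_dn s k x : x.1 = k.+1 :> nat -> touches k x.2 -> corner k (dn s x).
Proof.
case: x => l p /= e t; have [v|h] := boolP (vertical s k).
  by rewrite (@dn_vert _ _ _ k) ?v // /corner /= inordK ?ltnS 1?ltnW // !inE
    eqxx.
by rewrite (@dn_hor _ _ _ k) // /corner /= inord_other // e !inE eqxx orbT
  touches_other.
Qed.

Lemma arc_flips s s' k x y : flips s s' k -> arc s x y ->
  arc s' x y || corner k x && corner k y.
Proof.
move=> fl /arc_turn[]->.
  have [/andP[/eqP e t]|] := boolP (((x.1 : nat) == k) && touches k x.2).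
    by rewrite corner_up // /corner e t !inE eqxx orbT.
  by rewrite negb_and => /orP h; rewrite -(up_flips fl) ?arc_up.
have [/andP[/eqP e t]|] := boolP (((x.1 : nat) == k.+1) && touches k x.2).
  by rewrite corner_dn // /corner e t !inE eqxx !orbT.
by rewrite negb_and => /orP h; rewrite -(dn_flips fl) ?arc_dn.
Qed.

Section Split.
Variables (s s' : state w) (k : crossing w).
Hypothesis fl : flips s s' k.
Hypothesis c : connect (arc s) (bottom_left k) (top_right k).
Let bl := bottom_left k.
Let tr := top_right k.

Lemma corner_split x : corner k x -> connect (arc s) x bl.
Proof.
case/(corner_connect s)/orP=> // h; apply: connect_trans h _.
by rewrite connect_arc_sym.
Qed.

(** An arc of [s'] that is not an arc of [s] joins two corners, and all corners lie on a single
    circle of [s]. *)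
Lemma split_sub x y : connect (arc s') x y -> connect (arc s) x y.
Proof.
apply: connect_sub => {x y} x y /(arc_flips (flips_sym fl))/orP[/connect1//|].
case/andP=> /corner_split cx /corner_split cy; apply: connect_trans cx _.
by rewrite connect_arc_sym.
Qed.

(** Induction along a path of [s]: an arc that survives in [s'] stays with the same corner, and any
    other arc ends at a corner, which [corner_connect] places with one of the two. *)
Lemma split_cover x : 
  connect (arc s) bl x = connect (arc s') bl x || connect (arc s') tr x.
Proof.
apply/idP/orP=> [|[/split_sub //|/split_sub h]]; last exact: connect_trans c h.
have csym := connect_arc_sym s'.
suff H p : path (arc s) bl p ->
    connect (arc s') bl (last bl p) || connect (arc s') tr (last bl p).
  by case/connectP=> p /H h ->; apply/orP.
elim/last_ind: p => [|p z IH]; first by rewrite connect0.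
rewrite rcons_path last_rcons =>
  /andP[/IH h /(arc_flips fl)/orP[a|/andP[_ cz]]].
  by case/orP: h => h; rewrite (connect_trans h (connect1 a)) ?orbT.
by have := corner_connect s' cz; rewrite ![connect _ z _]csym.
Qed.

Lemma split_far x y : ~~ connect (arc s) bl x ->
  connect (arc s') x y = connect (arc s) x y.
Proof.
move=> nx; apply/idP/idP; first exact: split_sub.
have csym := connect_arc_sym s.
case/connectP=> p; elim: p x nx => [|z p IH] x nx /=.
  by move=> _ ->; rewrite connect0.
case/andP=> a pa ey; have az : ~~ connect (arc s) bl z.
  apply: contra nx => h; apply: connect_trans h _.
  by rewrite csym; exact: connect1.
case/orP: (arc_flips fl a) => [a'|/andP[/corner_split cx _]].
  by apply: connect_trans (connect1 a') _; exact: IH.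
by rewrite csym cx in nx.
Qed.

Lemma split_neq : ~~ connect (arc s') bl tr.
Proof. by have [] := split_circle fl c. Qed.

End Split.
End Circles.

(** * Edges of the cube that split a circle *)

Section Labels.
Variables (b : nat) (w : braid_word b).
Implicit Types (s : state w) (k : crossing w) (p q : point w) (x y : enhanced
  w).

Definition resmooth s k (v : bool) : state w :=
  [ffun j => if j == k then v else s j].

Lemma resmoothE s k v j : resmooth s k v j = if j == k then v else s j.
Proof. exact: ffunE. Qed.

Lemma resmooth_flips s k : flips s (resmooth s k (~~ s k)) k.
Proof. by split=> [|j /negPf nj]; rewrite resmoothE ?eqxx ?nj. Qed.

Lemma resmooth_resmooth s k u v :
  resmooth (resmooth s k u) k v = resmooth s k v.
Proof. by apply/ffunP=> j; rewrite !resmoothE; case: eqP. Qed.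

Lemma resmooth_id s k : resmooth s k (s k) = s.
Proof. by apply/ffunP=> j; rewrite !resmoothE; case: eqP => [->|]. Qed.

Lemma resmooth_on s k : s k -> resmooth s k true = s.
Proof. by move=> sk; rewrite -[RHS](resmooth_id s k) sk. Qed.

Lemma resmooth_flips0 s k : ~~ s k -> flips s (resmooth s k true) k.
Proof. by move=> /negPf h; have := resmooth_flips s k; rewrite h. Qed.

Lemma lab_connect y p q : connect (arc (st y)) p q -> lab y p = lab y q.
Proof. by move: (valP y) => /forallP/(_ p)/forallP/(_ q)/implyP h /h/eqP. Qed.

Lemma enhanced_eq x y : st x = st y -> lab x =1 lab y -> x = y.
Proof.
case: x y => [[s f] h] [[s' f'] h']; rewrite /st /lab /= => e1 e2.
by apply: val_inj; rewrite /= e1; congr (_, _); apply/ffunP.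
Qed.

Fact plus_subproof s : labelling s [ffun=> true].
Proof. by do 2!apply/forallP=> ?; rewrite !ffunE eqxx implybT. Qed.
Definition plus s : enhanced w := exist _ (s, [ffun=> true]) (plus_subproof s).

Fact mark_subproof s p : labelling s [ffun q => ~~ connect (arc s) p q].
Proof.
apply/forallP=> q; apply/forallP=> r; apply/implyP => c; rewrite !ffunE.
by rewrite (same_connect_r (connect_arc_sym s) c).
Qed.
Definition mark s p : enhanced w := exist _ (s, _) (mark_subproof s p).

Fact unmark_subproof p y :
  labelling (st y) [ffun q => lab y q || connect (arc (st y)) p q].
Proof.
apply/forallP=> q; apply/forallP=> r; apply/implyP => c; rewrite !ffunE.
by rewrite (lab_connect c) (same_connect_r (connect_arc_sym _) c).
Qed.
(** This undoes multiplication by v_- on the circle through [p], for those [y] that carry v_-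
    there. *)
Definition unmark p y : enhanced w := exist _ (st y, _) (unmark_subproof p y).

Lemma lab_plus s p : lab (plus s) p. Proof. by rewrite /lab /= ffunE. Qed.
Lemma lab_mark s p q : lab (mark s p) q = ~~ connect (arc s) p q.
Proof. by rewrite /lab /= ffunE. Qed.
Lemma lab_unmark p y q :
  lab (unmark p y) q = lab y q || connect (arc (st y)) p q.
Proof. by rewrite /lab /= ffunE. Qed.

Definition marked y := [exists p, y == mark (st y) p].

Lemma mark_eq s p q : connect (arc s) p q -> mark s p = mark s q.
Proof.
move=> c; apply: enhanced_eq => // r; rewrite !lab_mark.
by rewrite (same_connect (connect_arc_sym s) c).
Qed.

Lemma marked_mark s p : marked (mark s p).
Proof. by apply/existsP; exists p. Qed.

Lemma markedP y p : marked y -> ~~ lab y p -> y = mark (st y) p.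
Proof.
case/existsP=> q /eqP e; rewrite {1}e lab_mark negbK => c.
by rewrite {1}e; exact: mark_eq.
Qed.

Section SplitEdge.
Variables (s : state w) (k : crossing w).
Hypothesis sk : ~~ s k.
Hypothesis c : connect (arc s) (bottom_left k) (top_right k).
Let bl := bottom_left k.
Let tr := top_right k.
Let s' := resmooth s k true.
Let fl : flips s s' k := resmooth_flips0 sk.

Lemma far_split p : far_from s k p = ~~ connect (arc s) bl p.
Proof.
have csym := connect_arc_sym s.
by rewrite /far_from -/bl -/tr -(same_connect_r csym c) andbb csym.
Qed.

Lemma edge_split x y : st x = s -> edge k x y =
  [&& st y == s', [forall p, ~~ connect (arc s) bl p ==> (lab y p == lab x p)]
    & split_coef (lab x bl) (lab y bl) (lab y tr)].
Proof.
move=> e; rewrite /edge e sk c /=; congr [&& _, _ & _].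
by apply: eq_forallb => p; rewrite far_split.
Qed.

Let cover p : connect (arc s) bl p ->
  connect (arc s') bl p || connect (arc s') tr p.
Proof. by rewrite (split_cover fl c). Qed.

(** Delta(v_+) puts a single v_- on one of the two new circles. When there is only one v_- in all,
    differing labels at the corners say precisely that it sits on one of these circles. *)
Lemma edge_plus y :
  edge k (plus s) y = [&& st y == s', marked y & lab y bl != lab y tr].
Proof.
rewrite edge_split //; case: eqP => //= e; rewrite lab_plus /=.
have -> : (lab y bl != lab y tr) = lab y bl (+) lab y tr by rewrite negb_eqb.
case bt: (lab y bl (+) lab y tr); last by rewrite !andbF.
rewrite !andbT; apply/forallP/idP => [far|my p].
  have {}far p : ~~ connect (arc s) bl p -> lab y p.
    by move=> np; have := far p; rewrite np lab_plus => /eqP.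
  case lb: (lab y bl) in bt *.
    have lt : ~~ lab y tr by [].
    apply/existsP; exists tr; apply/eqP/enhanced_eq => // p; rewrite lab_mark e.
    have [cp|np] := boolP (connect _ tr p).
      by apply/negbTE; rewrite -(lab_connect (y := y) (p := tr)) ?e.
    have [cp|/far->//] := boolP (connect (arc s) bl p).
    have := cover cp; rewrite (negPf np) orbF => cb.
    by rewrite -(lab_connect (y := y) (p := bl)) ?e.
  apply/existsP; exists bl; apply/eqP/enhanced_eq => // p; rewrite lab_mark e.
  have [cp|np] := boolP (connect _ bl p).
    by apply/negbTE; rewrite -(lab_connect (y := y) (p := bl)) ?e // lb.
  have [cp|/far->//] := boolP (connect (arc s) bl p).
  have := cover cp; rewrite (negPf np) /= => cb.
  by rewrite -(lab_connect (y := y) (p := tr)) ?e.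
apply/implyP => np; rewrite lab_plus eqb_id;
  apply: contraR np => /(markedP my) ey.
move: bt; rewrite ey !lab_mark e.
have csym := connect_arc_sym s'.
have [cb _|_] := boolP (connect (arc s') p bl).
  by rewrite (split_cover fl c) csym cb.
have [ct _|_] := boolP (connect (arc s') p tr); last by [].
by rewrite (split_cover fl c) [X in _ || X]csym ct orbT.
Qed.

(** Multiplication by v_- commutes with splitting. If the circle of [p] is the one that splits,
    Delta(v_-) = v_-v_- becomes a term of Delta(v_+) once the new circle of [p] is relabelled;
    otherwise the circle of [p] is unaffected by the edge. *)
Lemma edge_mark p y :
  edge k (mark s p) y = ~~ lab y p && edge k (plus s) (unmark p y).
Proof.
rewrite !edge_split //; have [/= e|_] := eqVneq (st y) s';
  last by rewrite andbF.
have csym := connect_arc_sym s; have csym' := connect_arc_sym s'.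
rewrite lab_plus lab_mark !lab_unmark e /=.
have eL q r : connect (arc s') q r -> lab y q = lab y r.
  by move=> h; apply: lab_connect; rewrite e.
have [cp|np] := boolP (connect (arc s) p bl); rewrite /=.
  have far q : ~~ connect (arc s) bl q ->
      connect (arc s) p q = false /\ connect (arc s') p q = false.
    move=> nq; split; apply/negbTE; apply: contra nq => h.
      by apply: connect_trans h; rewrite csym.
    by apply: connect_trans (split_sub fl c h); rewrite csym.
  have -> : [forall q, ~~ connect (arc s) bl q ==> (lab y q == lab (mark s p)
    q)]
    = [forall q, ~~ connect (arc s) bl q ==> (lab (unmark p y) q == lab (plus
      s) q)].
    apply: eq_forallb => q; case: (boolP (connect _ bl q)) => //= /far[f1 f2].
    by rewrite lab_mark lab_plus lab_unmark e f1 f2 orbF.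
  rewrite [RHS]andbCA; congr (_ && _).
  have := cover (etrans (csym _ _) cp) => /orP[] h.
    have nt : connect (arc s') p tr = false.
      by apply/negbTE; apply: contra (split_neq fl c); exact: connect_trans h.
    by rewrite csym' h (eL _ _ h) nt orbT orbF.
  have nb : connect (arc s') p bl = false.
    apply/negbTE; apply: contra (split_neq fl c) => h'.
    by rewrite csym'; exact: connect_trans h h'.
  rewrite nb [connect _ p tr]csym' h (eL _ _ h) orbT orbF.
  by case: (lab y bl); case: (lab y p).
have npb : ~~ connect (arc s) bl p by rewrite csym.
have far q : connect (arc s') p q = connect (arc s) p q.
  rewrite csym' csym; case: (boolP (connect (arc s) bl q)) => [cq|nq].
    rewrite [RHS]csym; apply/idP/idP => h.
      by rewrite csym; exact: split_sub fl c _ _ h.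
    by case/negP: npb; apply: connect_trans cq _; rewrite csym.
  by rewrite (split_far fl c).
rewrite !far (negPf np) -(same_connect_r csym c) (negPf np) !orbF andbA.
congr (_ && _); apply/forallP/andP => [h|[np' /forallP h] q].
  split; first by have := h p; rewrite npb lab_mark connect0 => /eqP->.
  apply/forallP=> q; apply/implyP => nq; have := h q.
  rewrite nq lab_mark lab_unmark lab_plus e far => /eqP->.
  by case: connect.
apply/implyP => nq; have := h q; rewrite nq lab_mark lab_unmark lab_plus e far.
have [cq _|//] := boolP (connect (arc s) p q); last by rewrite orbF.
by rewrite -(eL p) ?far // eqbF_neg.
Qed.

Lemma edge_marked x p : st x = s -> edge k x (mark s' p) ->
  mark s' p = mark s' bl \/ mark s' p = mark s' tr.
Proof.
move=> e; rewrite edge_split // eqxx /= => /andP[_]; rewrite !lab_mark.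
have [/mark_eq -> _|_] := boolP (connect (arc s') p bl); first by left.
have [/mark_eq -> _|_] := boolP (connect (arc s') p tr); first by right.
by case: (lab x bl).
Qed.

Lemma edge_mark_sym x : st x = s ->
  edge k x (mark s' bl) = edge k x (mark s' tr).
Proof.
move=> e; rewrite !edge_split // !eqxx /= !lab_mark !connect0 /=.
have csym' := connect_arc_sym s'; rewrite [connect _ tr bl]csym'.
have n := split_neq fl c; congr (_ && _); last by rewrite (negPf n);
  case: (lab x bl).
apply: eq_forallb => q; rewrite !lab_mark;
  case: (boolP (connect (arc s) bl q)) => //=.
by rewrite (split_cover fl c) negb_or => /andP[/negPf -> /negPf ->].
Qed.

(** A marked target of [x] has its v_- on one of the two new circles, and by [edge_mark_sym] these
    two candidates occur together or not at all. *)
Lemma even_edge_marked x : st x = s ->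
  ~~ odd #|[pred y | [&& st y == s', marked y & edge k x y]]|.
Proof.
move=> e; set A := [pred y | _].
have nbt : mark s' bl != mark s' tr.
  apply/eqP=> /(congr1 (fun y => lab y tr)); rewrite !lab_mark connect0 /=.
  by rewrite (split_neq fl c).
case eb: (edge k x (mark s' bl)).
  have -> : #|A| = #|pred2 (mark s' bl) (mark s' tr)|.
    apply: eq_card => y; rewrite !inE; apply/and3P/orP.
      case=> /eqP ey /existsP[p /eqP ->]; rewrite ey => /(edge_marked e).
      by case=> ->; [left|right].
    by case=> /eqP ->; rewrite marked_mark eqxx -?edge_mark_sym // eb.
  by rewrite card2 nbt.
rewrite eq_card0 // => y; rewrite !inE;
  apply/and3P => -[/eqP ey /existsP[p /eqP ->]].
by rewrite ey => /[dup] /(edge_marked e)[] ->; rewrite -?edge_mark_sym // eb.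
Qed.

End SplitEdge.
End Labels.

(** * Chains supported on a twist region *)

Section Functional.
Variables (b : nat) (w : braid_word b).
Implicit Types (s : state w) (x y : enhanced w).

(** The argument is a level rather than a crossing because a telescoping sum will be evaluated at
    both ends of a region, and the upper end may be [size w]. *)
Definition sign (s : state w) (l : nat) : int :=
  (-1) ^+ #|[pred j : crossing w | (j < l)%N && s j]|.

Lemma incidenceE x y :
  incidence x y = \sum_(k : crossing w) sign (st x) k * (edge k x y)%:R.
Proof.
rewrite /incidence big_mkcond; apply: eq_bigr => k _.
by case: edge; rewrite ?mulr1 ?mulr0.
Qed.

Lemma edge_st k x y : edge k x y -> st x = resmooth (st y) k false /\ st y k.
Proof.
case/and4P=> nk /eqP -> _ _; split; last by rewrite ffunE eqxx.
apply/ffunP=> j; rewrite resmoothE ffunE; case: eqP => // ->.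
exact/negbTE.
Qed.

Definition marked_sum s (c : chain w) : int :=
  \sum_(y | (st y == s) && marked y) c y.

Lemma marked_sumD s : {morph marked_sum s : c c' / c + c'}.
Proof. by move=> c c'; rewrite -big_split; apply: eq_bigr => y _;
  rewrite ffunE. Qed.

Lemma marked_sum0 s : marked_sum s 0 = 0.
Proof. by apply: big1 => y _; rewrite ffunE. Qed.

Definition split_below s := forall k, s k ->
  connect (arc (resmooth s k false)) (bottom_left k) (top_right k).

(** By linearity it suffices to consider one source [x] and one crossing [k]; the number of marked
    targets over [s] is then even, as the edge is a split. *)
Lemma marked_sum_diff s (c : chain w) : split_below s ->
  (2 %| marked_sum s (diff c))%Z.
Proof.
move=> hs; rewrite /marked_sum.
under eq_bigr do rewrite ffunE.
rewrite exchange_big; apply: rpred_sum => x _ /=.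
rewrite -mulr_sumr dvdz_mull //.
under eq_bigr do rewrite incidenceE.
rewrite exchange_big; apply: rpred_sum => k _ /=.
rewrite -mulr_sumr dvdz_mull // -natr_sum.
rewrite (_ : (\sum_(y | _) _)%N =
    #|[pred y | [&& st y == s, marked y & edge k x y]]|); last first.
  rewrite -sum1_card big_mkcond [RHS]big_mkcond; apply: eq_bigr => y _ /=.
  by rewrite !inE andbA; case: (_ && marked y); case: edge.
have [/andP[sk /eqP ex]|h] := boolP (s k && (st x == resmooth s k false)).
  have nk : ~~ resmooth s k false k by rewrite resmoothE eqxx.
  have := even_edge_marked nk (hs k sk) ex.
  rewrite resmooth_resmooth resmooth_on // => ev.
  by rewrite natz dvdzE /= dvdn2.
rewrite eq_card0 ?dvdz0 // => y; rewrite !inE; apply: contraNF h.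
by move=> /and3P[/eqP <- _ /edge_st[-> ->]]; rewrite eqxx.
Qed.

End Functional.

(** * The all-plus and once-marked chains of a twist region and their differentials *)

Section Twist.
Variables (b : nat) (w : braid_word b) (P m : nat) (g : 'I_b).
Implicit Types (s : state w) (k : crossing w) (p q : point w) (x y : enhanced
  w).

Definition in_twist (k : crossing w) := (P <= k < P + m)%N.
Definition full_outside (s : state w) := forall k, ~~ in_twist k -> s k.
Definition twist_ones (s : state w) : nat := #|[pred k | in_twist k && s k]|.

(** These hypotheses isolate what the computation needs from the link. For a surrounded positive
    region of an alternating word, the last two are [region_split] and [region_ends]. *)
Hypothesis P_le : (P + m <= size w)%N.
Hypothesis twist_gen : forall k, in_twist k -> gen k = g.
Hypothesis twist_pos : forall k, in_twist k -> positive k.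
Hypothesis twist_split : forall s k, full_outside s -> (0 < twist_ones s)%N ->
  in_twist k -> ~~ s k -> connect (arc s) (bottom_left k) (top_right k).
Hypothesis twist_ends : forall s, full_outside s -> (0 < twist_ones s)%N ->
  connect (arc s) (pt w P g) (pt w (P + m) g).

Let X := pt w P g.

Lemma sum_twist (V : nmodType) (G : nat -> V) :
  \sum_(k : crossing w | in_twist k) G k = \sum_(P <= l < P + m) G l.
Proof.
rewrite (big_nat_widenl _ 0) // (big_nat_widen _ _ _ _ _ P_le) big_mkord.
by apply: eq_bigl => k; rewrite /in_twist.
Qed.

Lemma card_twist : #|[pred k | in_twist k]| = m.
Proof.
rewrite -sum1_card -[RHS](addKn P) -[RHS]muln1 -sum_nat_const_nat.
exact: (sum_twist (fun=> 1%N)).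
Qed.

Definition twist_state (j : nat) (s : state w) :=
  [forall k, ~~ in_twist k ==> s k] && (twist_ones s == j).

Lemma twist_stateP j s : reflect (full_outside s /\ twist_ones s = j)
  (twist_state j s).
Proof.
apply: (iffP andP) => [[/forallP h /eqP e]|[h e]]; split=> //.
- by move=> k; exact/implyP.
- by apply/forallP=> k; apply/implyP; exact: h.
- exact/eqP.
Qed.

Lemma twist_state_add j s k : in_twist k -> s k ->
  twist_state j (resmooth s k false) = twist_state j.+1 s.
Proof.
move=> rk sk; congr (_ && _).
  apply: eq_forallb => i; rewrite resmoothE; case: eqP => // ->.
  by rewrite rk.
rewrite -eqSS; congr (_ == _); rewrite /twist_ones [RHS](cardD1 k) !inE rk sk.
by congr (_.+1); apply: eq_card => i; rewrite !inE resmoothE; case: eqP;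
  rewrite ?andbF.
Qed.

Definition plus_chain (j : nat) : chain w :=
  [ffun x => (twist_state j (st x) && (x == plus (st x)))%:R].

(** The factor (-1)^P cancels the sign contributed by the [P] crossings below the region, all of
    which are smoothed to 1. *)
Definition mark_chain (j : nat) : chain w :=
  [ffun x => (-1) ^+ P * (twist_state j (st x) && (x == mark (st x) X))%:R].

Lemma sum_section (A : pred (state w)) (f : state w ->
  enhanced w) (F : enhanced w -> int) :
  (forall s, st (f s) = s) ->
  \sum_x (A (st x) && (x == f (st x)))%:R * F x = \sum_(s | A s) F (f s).
Proof.
move=> fK; rewrite [LHS](eq_bigr (fun x =>
    if A (st x) && (x == f (st x)) then F x else 0)); last first.
  by move=> x _; case: (_ && _); rewrite ?mul1r ?mul0r.
rewrite -big_mkcond (reindex_onto f (@st b w)) => [|x /andP[_ /eqP //]].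
by apply: eq_bigl => s; rewrite !fK !eqxx !andbT.
Qed.

Lemma diff_plus_chain_sum j y :
  diff (plus_chain j) y = \sum_(s | twist_state j s) incidence (plus s) y.
Proof.
rewrite ffunE; under eq_bigr do rewrite ffunE.
exact: (@sum_section _ (@plus b w)).
Qed.

Lemma diff_mark_chain_sum j y : diff (mark_chain j) y =
  (-1) ^+ P * \sum_(s | twist_state j s) incidence (mark s X) y.
Proof.
rewrite ffunE; under eq_bigr do rewrite ffunE -mulrA.
by rewrite -mulr_sumr (@sum_section _ (fun s => mark s X)).
Qed.

(** Only crossings of the region can still be 0, so every edge leaving [s] is a split and
    [edge_mark] applies. *)
Lemma incidence_mark j s y : (0 < j)%N -> twist_state j s ->
  incidence (mark s X) y = (~~ lab y X)%:R * incidence (plus s) (unmark X y).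
Proof.
move=> j0 /twist_stateP[fs es]; rewrite !incidenceE mulr_sumr;
  apply: eq_bigr => k _.
rewrite mulrCA; congr (_ * _).
have [sk|sk] := boolP (s k).
  by rewrite /edge /= /st /= sk mulr0.
have rk : in_twist k by apply: contraR sk; exact: fs.
have c : connect (arc s) (bottom_left k) (top_right k).
  by apply: twist_split; rewrite ?es.
by rewrite (edge_mark sk c) -mulnb natrM.
Qed.

Lemma diff_mark_chain j y : (0 < j)%N -> diff (mark_chain j) y =
  (-1) ^+ P * ((~~ lab y X)%:R * diff (plus_chain j) (unmark X y)).
Proof.
move=> j0; rewrite diff_mark_chain_sum diff_plus_chain_sum; congr (_ * _).
by rewrite mulr_sumr; apply: eq_bigr => s; exact: incidence_mark.
Qed.

Lemma sign_resmooth s k v : sign (resmooth s k v) k = sign s k.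
Proof.
congr (_ ^+ _); apply: eq_card => i; rewrite !inE resmoothE.
by case: eqP => // ->; rewrite ltnn.
Qed.

(** The source of an edge at [k] into [y] has the state of [y] with [k] switched off, so the double
    sum over states and crossings keeps at most one term for each crossing. *)
Lemma diff_plus_chain_crossings j y : (0 < j)%N ->
  diff (plus_chain j) y = (twist_state j.+1 (st y) && marked y)%:R *
   \sum_(k : crossing w | in_twist k) sign (st y) k *
      (st y k && (lab y (bottom_left k) != lab y (top_right k)))%:R.
Proof.
move=> j0; rewrite diff_plus_chain_sum.
under eq_bigr do rewrite incidenceE.
rewrite exchange_big mulr_sumr [RHS]big_mkcond; apply: eq_bigr => k _.
have [yk|yk] := boolP (st y k); last first.
  rewrite big1 => [|s _]; first by case: ifP; rewrite //= !mulr0.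
  by case: (boolP (edge _ _ _)) => [/edge_st[_]|]; rewrite ?(negPf yk) ?mulr0.
pose s0 := resmooth (st y) k false.
have s0k : ~~ s0 k by rewrite resmoothE eqxx.
have [h|h] := boolP (twist_state j s0); last first.
  rewrite big1 => [|s hs]; last first.
    case: (boolP (edge _ _ _)) => [/edge_st[e _]|]; rewrite ?mulr0 //.
    by rewrite -[s]/(st (plus s)) e (negPf h) in hs.
  by case: ifP => // rk; rewrite -(twist_state_add _ rk yk) (negPf h) mul0r.
rewrite (bigD1 s0) //= big1 ?addr0 => [|s /andP[_ ns]]; last first.
  case: (boolP (edge _ _ _)) => [/edge_st[e _]|]; rewrite ?mulr0 //.
  by rewrite -[s]/(st (plus s)) e eqxx in ns.
have [rk|nrk] := boolP (in_twist k); last first.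
  by case/twist_stateP: h => /(_ _ nrk); rewrite (negPf s0k).
rewrite -(twist_state_add _ rk yk) h /= sign_resmooth mulrCA; congr (_ * _).
case/twist_stateP: h => fs es.
have c : connect (arc s0) (bottom_left k) (top_right k).
  by apply: twist_split; rewrite ?es.
rewrite (edge_plus s0k c) resmooth_resmooth resmooth_on // eqxx /=.
by rewrite -mulnb natrM.
Qed.

Lemma sign_step s k : sign s k.+1 = (-1) ^+ s k * sign s k.
Proof.
rewrite /sign -exprD; congr (_ ^+ _); rewrite (cardD1 k) !inE ltnSn /=.
congr (_ + _)%N; apply: eq_card => i; rewrite !inE.
rewrite ltnS [(i <= k)%N]leq_eqVlt; case: eqVneq => [->|] /=;
  first by rewrite ltnn.
by move=> /negPf; rewrite -val_eqE /= => ->.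
Qed.

Lemma sign_start s : full_outside s -> sign s P = (-1) ^+ P.
Proof.
move=> fs; congr (_ ^+ _).
have le : (P <= size w)%N by apply: leq_trans P_le; exact: leq_addr.
have inj : injective (widen_ord le) by move=> i j [] /val_inj.
rewrite -{2}[P]card_ord -(card_imset _ inj).
apply: eq_card => i; rewrite !inE; apply/andP/imsetP => [[ip _]|[l _ ->]].
  by exists (Ordinal ip) => //; apply: val_inj.
split; first exact: (ltn_ord l).
by apply: fs; rewrite /in_twist /=; have := ltn_ord l; lia.
Qed.

Lemma sign_end s : sign s (P + m) = sign s P * (-1) ^+ twist_ones s.
Proof.
rewrite /sign -exprD; congr (_ ^+ _).
rewrite -(cardID [pred j : crossing w | (j < P)%N]); congr (_ + _)%N;
  apply: eq_card => i; rewrite !inE /in_twist; case: (s i); rewrite ?andbF //;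
    lia.
Qed.

Lemma telescope_twist j y : (0 < j)%N -> marked y -> twist_state j.+1 (st y) ->
  \sum_(k : crossing w | in_twist k) sign (st y) k *
      (st y k && (lab y (bottom_left k) != lab y (top_right k)))%:R =
  (-1) ^+ P * (1 + (-1) ^+ j) * (~~ lab y X)%:R.
Proof.
move=> j0 my hj; have [fs es] := twist_stateP _ _ hj.
(* [F] records, with sign, whether column [g] carries v_- at level [l]. Across a 0-smoothed crossing
   neither factor changes; across a 1-smoothed one the sign flips, so the increment adds the
   indicators of v_- at the two opposite corners. *)
pose F l := - (sign (st y) l * (~~ lab y (pt w l g))%:R).
have stepF k : in_twist k -> sign (st y) k *
    (st y k && (lab y (bottom_left k) != lab y (top_right k)))%:R = F k.+1 - F
      k.
  move=> rk; have pk := twist_pos rk; have gk := twist_gen rk.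
  rewrite /F opprK sign_step addrC bottom_left_pt top_right_pt gk.
  case sk: (st y k); last first.
    rewrite mulr0 mul1r (lab_connect (y := y) (p := pt w k g) (q :=
      pt w k.+1 g)) ?subrr //.
    by apply: connect_vert; rewrite ?ltnS 1?ltnW // /vertical pk sk.
  have hk : ~~ vertical (st y) k by rewrite /vertical pk sk.
  rewrite /= expr1 mulN1r mulNr opprK -mulrDr; congr (_ * _).
  have := connect_cap hk; rewrite gk => /(lab_connect (y := y)) ->.
  case lb: (lab y (pt w k g)); case lt: (lab y _) => //.
  (* If both corners carried v_-, they would lie on the same circle, as there is only one v_-; but
     the edge at [k] into this state splits them apart. *)
  pose s0 := resmooth (st y) k false.
  have s0k : ~~ s0 k by rewrite resmoothE eqxx.
  have [fs0 es0] : full_outside s0 /\ twist_ones s0 = j.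
    by apply/twist_stateP; rewrite twist_state_add.
  have := split_neq (resmooth_flips0 s0k) (twist_split fs0 _ rk s0k).
  rewrite es0 resmooth_resmooth resmooth_on // => /(_ j0).
  have -> := markedP my (negbT lb); rewrite bottom_left_pt top_right_pt gk.
  move: lt; rewrite (markedP my (negbT lb)) lab_mark.
  by move=> /negbFE ->.
rewrite (eq_bigr (fun k : crossing w => F k.+1 - F k)) //.
rewrite (sum_twist (fun l => F l.+1 - F l)) telescope_sumr ?leq_addr //.
(* The signs at the ends are (-1)^P and (-1)^(P+j+1), while the labels there agree by [twist_ends];
   this gives the factor 1 + (-1)^j. *)
rewrite /F opprK sign_end // sign_start // es -exprD.
have -> : lab y (pt w (P + m) g) = lab y X.
  by apply/esym/lab_connect/twist_ends; rewrite ?es.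
rewrite exprD exprS -/X; ring.
Qed.


Lemma diff_plus_chain j y : (0 < j)%N -> diff (plus_chain j) y =
  (1 + (-1) ^+ j) * mark_chain j.+1 y.
Proof.
move=> j0; rewrite diff_plus_chain_crossings // ffunE.
have [/= h|_] := boolP (twist_state _ _); last by rewrite mulr0n !mulr0 mul0r.
have [my|nmy] := boolP (marked y); last first.
  case: eqP => [e|_]; last by rewrite !mulr0 mul0r.
  by rewrite e marked_mark in nmy.
rewrite mul1r (telescope_twist j0 my h).
have -> : ~~ lab y X = (y == mark (st y) X).
  apply/idP/eqP => [|->]; first exact: markedP.
  by rewrite lab_mark connect0.
by ring.
Qed.

Lemma diff_plus_chain_even j : (0 < j)%N -> ~~ odd j ->
  diff (plus_chain j) = mark_chain j.+1 *+ 2.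
Proof.
move=> j0 ev; apply/ffunP=> y;
  rewrite diff_plus_chain // -(signr_odd _ j) (negPf ev).
by rewrite mulr2n [RHS]ffunE mulrDl mul1r.
Qed.

(** Multiplication by v_- on [X] carries the vanishing of [diff (plus_chain j)] for odd [j] over to
    [mark_chain j]. *)
Lemma diff_mark_chain_odd j : odd j -> diff (mark_chain j) = 0.
Proof.
move=> oj; have j0 : (0 < j)%N by case: j oj.
apply/ffunP=> y; rewrite diff_mark_chain // diff_plus_chain // -(signr_odd _ j)
  oj.
by rewrite subrr mul0r !mulr0 ffunE.
Qed.

Lemma marked_sum_mark_chain j s :
  marked_sum s (mark_chain j) = (-1) ^+ P * (twist_state j s)%:R.
Proof.
rewrite /marked_sum; under eq_bigr do rewrite ffunE.
rewrite -mulr_sumr; congr (_ * _).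
rewrite (bigD1 (mark s X)) /= ?eqxx ?marked_mark // big1 ?addr0.
  by rewrite andbT.
by move=> y /andP[/andP[/eqP -> _] /negPf ->]; rewrite andbF.
Qed.

(** * Bidegrees of the chains *)

Definition zeros s := #|[pred k | ~~ s k]|.

(** Induction on the zeros: switching one of them on is a split and creates one circle. The number
    of circles thus depends only on the number of ones, which makes the chains homogeneous. *)
Lemma n_comp_zeros s : full_outside s -> (0 < twist_ones s)%N ->
  (n_comp (arc s) predT + zeros s = n_comp (arc ([ffun=> true] : state w))
    predT)%N.
Proof.
move: {2}(zeros s) (erefl (zeros s)) => d; elim: d s => [|d IH] s ez fs os.
  have -> : s = [ffun=> true].
    by apply/ffunP=> k; rewrite ffunE; have := card0_eq ez k;
      rewrite !inE => /negbFE.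
  rewrite -[RHS]addn0; congr (_ + _)%N; apply: eq_card0 => k.
  by rewrite !inE ffunE.
have /card_gt0P[k] : (0 < #|[pred k | ~~ s k]|)%N by rewrite -/(zeros s) ez.
rewrite inE => nk.
have rk : in_twist k by apply: contraR nk; exact: fs.
set s' := resmooth s k true.
have ez' : zeros s' = d.
  apply/eqP; rewrite -eqSS -ez /zeros [in X in _ == X](cardD1 k) !inE nk eqSS.
  apply/eqP/eq_card => i; rewrite !inE resmoothE; case: eqP => //.
have fs' : full_outside s'.
  by move=> i /fs si; rewrite resmoothE; case: eqP.
have os' : (0 < twist_ones s')%N.
  apply: leq_trans os _; apply: subset_leq_card; apply/subsetP=> i.
  by rewrite !inE resmoothE => /andP[-> ->]; case: eqP.
rewrite -(IH s' ez' fs' os') ez ez'.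
by have [_ ->] := split_circle (resmooth_flips0 nk) (twist_split fs os rk nk);
  rewrite addSnnS.
Qed.

Lemma zeros_twist j s : twist_state j s -> (zeros s + j = m)%N.
Proof.
case/twist_stateP=> fs <-.
rewrite -card_twist -[RHS](cardID [pred k | s k]) addnC; congr (_ + _)%N.
  apply: eq_card => k; rewrite !inE.
  by case: (boolP (s k)) => //= nk; apply/esym; apply: contraR nk; exact: fs.
Qed.

Lemma height_zeros s : (height s + zeros s = size w)%N.
Proof. by rewrite -[RHS]card_ord -(cardC [pred k | s k]). Qed.

Lemma label_degree_plus s : label_degree (plus s) = (n_comp (arc s) predT)%:Z.
Proof.
rewrite /label_degree (eq_n_comp_r (a' := predT)).
  rewrite [X in _ - X%:Z](_ : _ = 0%N) ?subr0 //.
  by apply: eq_card0 => p; rewrite !inE lab_plus andbF.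
by move=> p; rewrite !inE lab_plus.
Qed.

Lemma label_degree_mark s p :
  label_degree (mark s p) = (n_comp (arc s) predT)%:Z - 2%:Z.
Proof.
have csym := connect_arc_sym s.
have -> : n_comp (arc s) predT = (1 + n_comp (arc s) [predC connect (arc s)
  p])%N.
  by rewrite (n_compC (connect (arc s) p)) n_comp_connect.
rewrite /label_degree -[st _]/s.
rewrite (eq_n_comp_r (a' := [predC connect (arc s) p])); last first.
  by move=> q; rewrite !inE lab_mark.
rewrite [X in _ - X%:Z](_ : _ = 1%N).
  by rewrite PoszD; set u := Posz _; rewrite -[X in _ = _ + X - _]/u; lia.
rewrite -(n_comp_connect csym p); apply: eq_n_comp_r => q.
by rewrite !inE lab_mark negbK.
Qed.

(** With [j > 0] ones in the region there are [m - j] zeros, and both the height and the number of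
    circles are [m - j] below their values at the all-ones state. *)
Definition twist_bidegree (j : nat) : int * int :=
  ((size w)%:Z + j%:Z - m%:Z - (n_minus w)%:Z,
   (n_comp (arc ([ffun=> true] : state w)) predT)%:Z
     + (size w)%:Z + (2 * j)%:Z - (2 * m)%:Z + (n_plus w)%:Z - (2 * n_minus
       w)%:Z).

Lemma bidegree_plus j s : (0 < j)%N -> twist_state j s ->
  bidegree (plus s) = twist_bidegree j.
Proof.
move=> j0 hs; have [fs es] := twist_stateP _ _ hs.
have := n_comp_zeros fs; rewrite es => /(_ j0).
have := zeros_twist hs; have := height_zeros s.
by rewrite /bidegree /twist_bidegree label_degree_plus -[st _]/s => h1 h2 h3;
  congr (_, _); lia.
Qed.

(** Compared with [j] ones, the quantum degree gains 1 from the height and 1 from the new circle,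
    and loses 2 to the v_-. *)
Lemma bidegree_mark j s p : (0 < j)%N -> twist_state j.+1 s ->
  bidegree (mark s p) = ((twist_bidegree j).1 + 1, (twist_bidegree j).2).
Proof.
move=> j0 hs; have [fs es] := twist_stateP _ _ hs.
have := n_comp_zeros fs; rewrite es => /(_ isT).
have := zeros_twist hs; have := height_zeros s.
rewrite /bidegree /twist_bidegree label_degree_mark -[st _]/s => h1 h2.
by move: (n_comp _ _) (n_comp _ _) => N N' h3; congr (_, _); rewrite /=; lia.
Qed.

Lemma homogeneous_plus_chain j : (0 < j)%N ->
  homogeneous (twist_bidegree j) (plus_chain j).
Proof.
move=> j0; apply/forallP=> x; rewrite ffunE.
have [/andP[h /eqP ->]|] := boolP (_ && _); last by rewrite eqxx.
by rewrite (bidegree_plus j0 h) eqxx implybT.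
Qed.

Lemma homogeneous_mark_chain j : (0 < j)%N ->
  homogeneous ((twist_bidegree j).1 + 1,
    (twist_bidegree j).2) (mark_chain j.+1).
Proof.
move=> j0; apply/forallP=> x; rewrite ffunE.
have [/andP[h /eqP ->]|] := boolP (_ && _); last by rewrite mulr0 eqxx.
by rewrite (bidegree_mark _ j0 h) eqxx implybT.
Qed.

Definition initial_state (j : nat) : state w :=
  [ffun k => ~~ in_twist k || (k < P + j)%N].

End Twist.

Lemma twist_initial_state b (w : braid_word b) P m j :
  (P + m <= size w)%N -> (j <= m)%N ->
    twist_state P m j (initial_state w P m j).
Proof.
move=> le jm; apply/twist_stateP; split=> [k nk|]; first by rewrite ffunE nk.
have lej : (P + j <= size w)%N by lia.
rewrite -[RHS](card_twist lej); apply: eq_card => k;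
  rewrite !inE ffunE /in_twist.
by lia.
Qed.

(** * Circles of alternating 3-braids *)

Section Columns.
Local Open Scope nat_scope.
Variables (b : nat) (w : braid_word b).
Implicit Types (s : state w) (k : crossing w).

Lemma connect_column s p l1 l2 : p < b.+1 -> l1 <= l2 <= size w ->
  (forall k, l1 <= k < l2 -> vertical s k || ~~ touches k p) ->
  connect (arc s) (pt w l1 p) (pt w l2 p).
Proof.
move=> hp; elim: l2 => [|l2 IH] /andP[le12 le2] h.
  by move: le12; rewrite leqn0 => /eqP->.
move: le12; rewrite leq_eqVlt => /orP[/eqP-> //|lt].
apply: (@connect_trans _ _ (pt w l2 p)).
  by apply: IH => [|k hk]; [lia | apply: h; lia].
by apply: (@connect_vert _ _ s (Ordinal le2)) => //; apply: h => /=; lia.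
Qed.

(** Both strand lines rise vertically to the first horizontal crossing, whose cup joins them. *)
Lemma connect_twist_bottom s (g : 'I_b) l1 l2 : l2 <= size w ->
  (forall k, l1 <= k < l2 -> gen k = g) ->
  (exists2 k : crossing w, l1 <= k < l2 & ~~ vertical s k) ->
  connect (arc s) (pt w l1 g) (pt w l1 g.+1).
Proof.
move=> le2; move: {2}(l2 - l1) (erefl (l2 - l1)) => d.
elim: d l1 => [|d IH] l1 ed hg [k hk hs]; first lia.
have l1P : l1 < size w by lia.
pose k1 : crossing w := Ordinal l1P.
have g1 : gen k1 = g by apply: hg => /=; lia.
have [v|h] := boolP (vertical s k1); last first.
  by have := connect_cup h; rewrite g1.
have k1k : k1 != k by apply: contraNneq hs => <-.
have up p : p < b.+1 -> connect (arc s) (pt w l1 p) (pt w l1.+1 p).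
  by move=> hp; apply: (@connect_vert _ _ s k1); rewrite ?v.
apply: connect_trans (up g (ltnW _)) _; first by rewrite ltnS.
rewrite connect_arc_sym; apply: connect_trans (up g.+1 _) _;
  first by rewrite ltnS.
rewrite connect_arc_sym; apply: IH => [|j hj|]; first lia.
  by apply: hg; lia.
by exists k => //; move: k1k; rewrite -val_eqE /=; lia.
Qed.

Lemma connect_twist_top s (g : 'I_b) l1 l2 : l2 <= size w ->
  (forall k, l1 <= k < l2 -> gen k = g) ->
  (exists2 k : crossing w, l1 <= k < l2 & ~~ vertical s k) ->
  connect (arc s) (pt w l2 g) (pt w l2 g.+1).
Proof.
elim: l2 => [|l2 IH] le2 hg [k hk hs]; first lia.
pose k2 : crossing w := Ordinal le2.
have g2 : gen k2 = g by apply: hg => /=; lia.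
have [v|h] := boolP (vertical s k2); last first.
  by have := connect_cap h; rewrite g2.
have k2k : k2 != k by apply: contraNneq hs => <-.
have up p : p < b.+1 -> connect (arc s) (pt w l2.+1 p) (pt w l2 p).
  by move=> hp; rewrite connect_arc_sym; apply: (@connect_vert _ _ s k2);
    rewrite ?v.
apply: connect_trans (up g (ltnW _)) _; first by rewrite ltnS.
rewrite connect_arc_sym; apply: connect_trans (up g.+1 _) _;
  first by rewrite ltnS.
rewrite connect_arc_sym; apply: IH => [|j hj|]; first lia.
  by apply: hg; lia.
by exists k => //; move: k2k; rewrite -val_eqE /=; lia.
Qed.

(** If the horizontal crossing lies below [k], the two strand lines at level [k] are joined by
    turning back above it; if it lies above, the two lines at level [k.+1] are joined beneath it. *)
Lemma connect_twist s (g : 'I_b) l1 l2 k : l2 <= size w ->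
  (forall k, l1 <= k < l2 -> gen k = g) -> l1 <= k < l2 -> vertical s k ->
  (exists2 k' : crossing w, l1 <= k' < l2 & ~~ vertical s k') ->
  connect (arc s) (bottom_left k) (top_right k).
Proof.
move=> le2 hg hk v [k' hk' hs].
have kk' : k' != k by apply: contraNneq hs => ->.
rewrite bottom_left_pt top_right_pt (hg k hk).
have up p : p < b.+1 -> connect (arc s) (pt w k p) (pt w k.+1 p).
  by move=> hp; apply: connect_vert; rewrite ?v.
have [lt|ge] := ltnP k' k.
  apply: (@connect_trans _ _ (pt w k g.+1)); last by apply: up; rewrite ltnS.
  apply: (@connect_twist_top s g l1 k) => [|j hj|]; [lia | apply: hg; lia |].
  by exists k' => //; lia.
apply: connect_trans (up g _) _; first by rewrite ltnS ltnW.
apply: (@connect_twist_bottom s g k.+1 l2) => // [j hj|]; first by apply: hg;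
  lia.
by exists k' => //; move: kk'; rewrite -val_eqE /=; lia.
Qed.

End Columns.

(** * Twist regions of an alternating word *)

Section Alternating.
Variables (t : nat) (a : 'I_(2 * t) -> int).
Hypothesis a_neq0 : forall i, a i != 0.
Let w := alternating_word a.
Implicit Types (i j : 'I_(2 * t)) (s : state w) (k : crossing w).

Definition letter i : 'I_2 * bool := (if odd i then ord_max else ord0, 0 < a i).

Definition prefix_word (l : nat) : braid_word 2 :=
  flatten [seq nseq `|a i|%N (letter i) | i <- take l (enum 'I_(2 * t))].

Definition level (l : nat) : nat := size (prefix_word l).

Lemma prefix_wordS i : prefix_word i.+1 = prefix_word i ++ nseq `|a i|%N
  (letter i).
Proof.
rewrite /prefix_word (take_nth i) ?size_enum_ord // nth_ord_enum map_rcons.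
by rewrite flatten_rcons.
Qed.

Lemma levelS i : level i.+1 = (level i + `|a i|)%N.
Proof. by rewrite /level prefix_wordS size_cat size_nseq. Qed.

Lemma level_end : level (2 * t) = size w.
Proof. by rewrite /level /prefix_word take_oversize ?size_enum_ord. Qed.

Lemma word_prefix l : exists u, w = prefix_word l ++ u.
Proof.
exists (flatten [seq nseq `|a i|%N (letter i) | i <- drop l (enum 'I_(2 * t))]).
by rewrite -flatten_cat -map_cat cat_take_drop.
Qed.

Lemma level_le l : (level l <= size w)%N.
Proof. by have [u ->] := word_prefix l; rewrite size_cat leq_addr. Qed.

Definition region i k := in_twist (level i) `|a i|%N k.

Lemma region_letter i k : region i k -> tnth (in_tuple w) k = letter i.
Proof.
rewrite /region /in_twist (tnth_nth (letter i)) /=; move: (k : nat) => l hk.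
have [u ->] := word_prefix i.+1; rewrite nth_cat -/(level i.+1) levelS.
case: ifP; last lia; rewrite prefix_wordS nth_cat -/(level i).
by case: ifP => [|_ _]; [lia | rewrite nth_nseq; case: ifP => //; lia].
Qed.

Lemma region_gen i k : region i k -> gen k = if odd i then ord_max else ord0.
Proof. by rewrite /gen => /region_letter ->. Qed.

Lemma region_positive i k : region i k -> positive k = (0 < a i).
Proof. by rewrite /positive => /region_letter ->. Qed.

Lemma ex_region k : exists i, region i k.
Proof.
suff H l : (l <= 2 * t)%N -> (k < level l)%N -> exists i, region i k.
  by apply: (H (2 * t)%N) => //; rewrite level_end.
elim: l => [|l IH] hl; first by rewrite /level /prefix_word take0.
have [lt|ge] := ltnP k (level l); first by move=> _; apply: IH => //;
  exact: ltnW.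
have := levelS (Ordinal hl); rewrite /= => -> hk.
by exists (Ordinal hl); rewrite /region /in_twist ge.
Qed.

Lemma level_mono (l l' : nat) : (l <= l')%N -> (level l <= level l')%N.
Proof.
elim: l' => [|l' IH]; first by rewrite leqn0 => /eqP->.
rewrite leq_eqVlt => /orP[/eqP-> //|/IH /leq_trans -> //].
have [lt|ge] := ltnP l' (2 * t).
  by have := levelS (Ordinal lt) => /= ->; exact: leq_addr.
rewrite /level /prefix_word !take_oversize ?size_enum_ord //; exact: leqW.
Qed.

Lemma region_inj i j k : region i k -> region j k -> i = j.
Proof.
rewrite /region /in_twist -!levelS => hi hj; apply/val_inj/eqP.
rewrite /= eqn_leq; apply/andP; split; rewrite leqNgt; apply/negP=> lt.
  by have := level_mono lt; lia.
by have := level_mono lt; lia.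
Qed.

Lemma abs_gt0 i : (0 < `|a i|)%N.
Proof. by rewrite absz_gt0. Qed.

Lemma region_le i : (level i + `|a i| <= size w)%N.
Proof. by rewrite -levelS level_le. Qed.

(** Both generators meet the middle column 1, so the column that bypasses region [i] is 0 or 2. *)
Definition other_column i : nat := if odd i then 0 else 2.
Definition low_column i : nat := if odd i then 1 else 0.

Lemma region_low i k : region i k -> gen k = low_column i :> nat.
Proof. by move/region_gen->; rewrite /low_column; case: odd. Qed.

(** The number of regions is even, so the alternation of the two generators persists across the
    wrap-around. *)
Lemma odd_ordS i : odd (ordS i) = ~~ odd i.
Proof.
rewrite /=; have := ltn_ord i; rewrite leq_eqVlt => /orP[/eqP e|lt].
  have eo : odd i.+1 = false by rewrite e mul2n odd_double.
  by rewrite e modnn -[RHS]/(odd i.+1) eo.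
by rewrite modn_small.
Qed.

Lemma odd_ord_pred i : odd (ord_pred i) = ~~ odd i.
Proof. by rewrite -{2}[i]ord_predK odd_ordS negbK. Qed.

Lemma connect_levelS s i (p : nat) : (p < 3)%N ->
  connect (arc s) (pt w (level i.+1) p) (pt w (level (ordS i)) p).
Proof.
move=> hp; rewrite /=; have := ltn_ord i; rewrite leq_eqVlt => /orP[/eqP e|lt].
  rewrite e modnn level_end /level /prefix_word take0; exact: connect_wrap.
by rewrite modn_small.
Qed.

Definition region_horizontal s i := forall k, region i k -> ~~ vertical s k.

Lemma first_crossing i : exists2 k, region i k & k = level i :> nat.
Proof.
have h : (level i < size w)%N.
  by apply: leq_trans (region_le i); have := abs_gt0 i; lia.
by exists (Ordinal h) => //; rewrite /region /in_twist /=; have := abs_gt0 i;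
  lia.
Qed.

Lemma last_crossing i : exists2 k, region i k & k.+1 = level i.+1 :> nat.
Proof.
have := region_le i; have := abs_gt0 i; rewrite levelS => h1 h2.
have h : ((level i + `|a i|).-1 < size w)%N by lia.
by exists (Ordinal h) => //; rewrite /region /in_twist /=; lia.
Qed.

Lemma connect_first s i : region_horizontal s i ->
  connect (arc s) (pt w (level i) (low_column i)) (pt w (level i) (low_column
    i).+1).
Proof.
move=> h; have [k rk <-] := first_crossing i.
by rewrite -(region_low rk); apply/connect_cup/h.
Qed.

Lemma connect_last s i : region_horizontal s i ->
  connect (arc s) (pt w (level i.+1) (low_column i)) (pt w (level i.+1)
    (low_column i).+1).
Proof.
move=> h; have [k rk <-] := last_crossing i.
by rewrite -(region_low rk); apply/connect_cap/h.
Qed.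

(* From the middle column, pass to the third column around the neighbouring
   twist regions, and run along it past the twist region. *)
Lemma connect_past s i :
  region_horizontal s (ord_pred i) -> region_horizontal s (ordS i) ->
  connect (arc s) (pt w (level i) 1) (pt w (level i.+1) 1).
Proof.
move=> hp hS; have csym := connect_arc_sym s.
have o3 : (other_column i < 3)%N by rewrite /other_column; case: odd.
apply: (@connect_trans _ _ (pt w (level i) (other_column i))).
  have := connect_levelS s (ord_pred i); rewrite ord_predK => c.
  apply: connect_trans (_ : connect _ _ (pt w (level (ord_pred i).+1) 1)) _.
    by rewrite csym; exact: c.
  apply: connect_trans (c _ o3); have := connect_last hp.
  rewrite /low_column odd_ord_pred /other_column; case: odd => //=.
  by rewrite csym.
apply: (@connect_trans _ _ (pt w (level i.+1) (other_column i))).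
  apply: connect_column => // [|k].
    by rewrite level_le level_mono.
  rewrite levelS => rk; apply/orP; right.
  rewrite /touches (region_low (i := i)) // /low_column /other_column.
  by case: odd.
apply: connect_trans (connect_levelS s i o3) _.
rewrite csym; apply: connect_trans (connect_levelS s i _) _ => //.
have := connect_first hS.
rewrite /low_column odd_ordS /other_column; case: odd => //=.
by rewrite csym.
Qed.

Lemma connect_region s i k : region i k -> vertical s k ->
  (exists2 k', region i k' & ~~ vertical s k') ->
  connect (arc s) (bottom_left k) (top_right k).
Proof.
move=> rk v h; apply: (connect_twist (region_le i) _ rk v h).
exact: region_gen.
Qed.

(** * Splittings around a surrounded positive region *)

Section Region.
Variable i : 'I_(2 * t).
Hypothesis ai_gt0 : 0 < a i.
Hypothesis ai_surr : surrounded a i.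
Hypothesis a_neq1 : forall j, a j != 1.
Hypothesis a_neg : forall j, a j < 0 -> surrounded a j.

Let P := level i.
Let m := `|a i|%N.
Let g : 'I_2 := if odd i then ord_max else ord0.

Lemma g_low : g = low_column i :> nat.
Proof. by rewrite /g /low_column; case: odd. Qed.

Lemma full_horizontal s j : full_outside P m s -> j != i -> 0 < a j ->
  region_horizontal s j.
Proof.
move=> fs ji aj k rk; rewrite /vertical (region_positive rk) aj /= negbK.
by apply: fs; apply: contra ji => /(region_inj rk)->.
Qed.

Lemma ordS_neq j : ordS j != j.
Proof.
by apply/eqP=> e; have := odd_ordS j; rewrite e; case: odd.
Qed.

Lemma ord_pred_neq j : ord_pred j != j.
Proof.
by apply/eqP=> e; have := odd_ord_pred j; rewrite e; case: odd.
Qed.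

Lemma region_has_horizontal s : (0 < twist_ones P m s)%N ->
  exists2 k, region i k & ~~ vertical s k.
Proof.
case/card_gt0P=> k; rewrite inE => /andP[rk sk]; exists k => //.
by rewrite /vertical (region_positive rk) ai_gt0 sk.
Qed.

Lemma region_split s k : full_outside P m s -> (0 < twist_ones P m s)%N ->
  in_twist P m k -> ~~ s k -> connect (arc s) (bottom_left k) (top_right k).
Proof.
move=> fs os rk sk; apply: (connect_region rk _ (region_has_horizontal os)).
by rewrite /vertical (region_positive rk) ai_gt0 (negPf sk).
Qed.

(** The detour of [connect_past] joins the two ends of the region in the middle column. When the
    left line of the region is column 0, the turns inside the region lead from it to the middle. *)
Lemma region_ends s : full_outside P m s -> (0 < twist_ones P m s)%N ->
  connect (arc s) (pt w P g) (pt w (P + m) g).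
Proof.
move=> fs os; have hor := region_has_horizontal os.
have csym := connect_arc_sym s.
case/andP: ai_surr => ap aS.
have past : connect (arc s) (pt w P 1) (pt w (P + m) 1).
  rewrite -levelS; apply: connect_past; apply: full_horizontal => //.
    exact: ord_pred_neq.
  exact: ordS_neq.
have gl (k : crossing w) : (P <= k < P + m)%N -> gen k = g by exact: region_gen.
have bot := connect_twist_bottom (region_le i) gl hor.
have top := connect_twist_top (region_le i) gl hor.
rewrite g_low in bot top *; rewrite /low_column in bot top *.
case: odd bot top => // bot top.
by apply: connect_trans bot (connect_trans past _); rewrite csym.
Qed.

(** There are three reasons for an edge into [s] to be a split: in region [i] another 1 remains
    since [1 < j]; in another positive region another 1 remains since the exponent is at least 2; in
    a negative region the circle closes up around it through the positive neighbours. *)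
Lemma region_split_below s (j : nat) : (1 < j)%N -> twist_state P m j s ->
  split_below s.
Proof.
move=> j1 /twist_stateP[fs es] k sk; set s' := resmooth s k false.
have [l rk] := ex_region k.
have s'k : s' k = false by rewrite resmoothE eqxx.
have other_one k' : k' != k -> s k' -> s' k' by rewrite resmoothE => /negPf->.
have [al|al] := ltP 0 (a l).
  apply: (connect_region rk);
    first by rewrite /vertical (region_positive rk) al s'k.
  suff [k' [nk' rk' sk']] : exists k', [/\ k' != k, region l k' & s k'].
    by exists k' => //; rewrite /vertical (region_positive rk') al other_one.
  have [li|li] := eqVneq l i.
    have rki : in_twist P m k by move: rk; rewrite li.
    move: j1; rewrite -es /twist_ones (cardD1 k) !inE rki sk ltnS.
    case/card_gt0P=> k'; rewrite !inE => /and3P[nk' rk' sk'].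
    by exists k'; split=> //; rewrite li.
  have al2 : (1 < `|a l|)%N by have := a_neq1 l; lia.
  have H k' : region l k' -> s k'.
    by move=> rk'; apply: fs; apply: contra li => /(region_inj rk')->.
  (* The first and last crossings of the region are different, so one of them is not [k]. *)
  have [k1 r1 e1] := first_crossing l; have [k2 r2 e2] := last_crossing l.
  have [e|n] := eqVneq k1 k; last by exists k1; split=> //; exact: H.
  exists k2; split=> //; last exact: H.
  by rewrite -e -val_eqE /=; move: e2; rewrite levelS; lia.
(* Now [k] is horizontal in [s'] and the rest of its region is vertical. Column 1 leads down from
   [k], around the region and back to [k] from above; the cup or the cap at [k] reaches the
   remaining corner. *)
have {}al : a l < 0 by rewrite lt_neqAle a_neq0.
have /andP[lp lS] := a_neg al.
have hor l' : 0 < a l' -> l' != i -> region_horizontal s' l'.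
  move=> al' n k' rk'; rewrite /vertical (region_positive rk') al' /= negbK.
  apply: other_one; first by apply: contraTneq rk' => ->;
    apply/negP => /(region_inj rk) e; rewrite e in al; lia.
  by apply: fs; apply: contra n => /(region_inj rk')->.
case/andP: ai_surr => ip iS.
have past : connect (arc s') (pt w (level l) 1) (pt w (level l.+1) 1).
  (* The neighbours of [l] are not [i], since the neighbours of [i] have positive exponents. *)
  apply: connect_past; apply: hor => //; apply/eqP=> e.
    by move: iS; rewrite -e ord_predK; lia.
  by move: ip; rewrite -e ordSK; lia.
have vert k' : k' != k -> region l k' -> vertical s' k'.
  move=> nk' rk'; rewrite /vertical (region_positive rk') ltNge (ltW al) /=.
  apply: other_one => //; apply: fs; apply/negP=> /(region_inj rk') e.
  by rewrite e in al; lia.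
have hk : ~~ vertical s' k.
  by rewrite /vertical (region_positive rk) ltNge (ltW al) s'k.
have rk2 := rk; rewrite /region /in_twist -levelS in rk2.
have csym := connect_arc_sym s'.
have le := level_le l.+1.
have low : connect (arc s') (pt w k 1) (pt w (level l) 1).
  rewrite csym; apply: connect_column => // [|k' hk']; first by lia.
  rewrite vert //; first by rewrite -val_eqE /=; lia.
  by rewrite /region /in_twist -levelS; lia.
have high : connect (arc s') (pt w (level l.+1) 1) (pt w k.+1 1).
  rewrite csym; apply: connect_column => // [|k' hk']; first by lia.
  rewrite vert //; first by rewrite -val_eqE /=; lia.
  by rewrite /region /in_twist -levelS; lia.
have mid := connect_trans low (connect_trans past high).
rewrite bottom_left_pt top_right_pt; have := connect_cup hk;
  have := connect_cap hk.
rewrite (region_low rk) /low_column; case: odd => cap cup.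
  exact: connect_trans mid cap.
exact: connect_trans cup mid.
Qed.

End Region.
End Alternating.

(** * From chains to torsion classes *)

Section Torsion.
Local Open Scope quotient_scope.
Variables (b : nat) (w : braid_word b) (T : finType).
(** Modulo 2, [phi t] kills coboundaries and the family [phi] is dual to [z], which will certify
    independence of the classes; [c] certifies that their doubles vanish. *)
Variables (z c : T -> chain w) (hq : T -> int * int) (phi : T -> chain w ->
  int).
Hypothesis hq_codom : forall t, hq t \in codom (@bidegree b w).
Hypothesis z_hom : forall t, homogeneous (hq t) (z t).
Hypothesis diff_z : forall t, diff (z t) = 0.
Hypothesis c_hom : forall t, homogeneous ((hq t).1 - 1, (hq t).2) (c t).
Hypothesis diff_c : forall t, diff (c t) = z t *+ 2.
Hypothesis phi0 : forall t, phi t 0 = 0.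
Hypothesis phiD : forall t, {morph phi t : x y / x + y}.
Hypothesis phi_diff : forall t x, (2 %| phi t (diff x))%Z.
Hypothesis phi_z : forall t t', (2 %| phi t (z t'))%Z = (t != t').

Fact z_cocycle t : is_cocycle (hq t) (z t).
Proof. by apply/andP; split; [exact: z_hom | apply/eqP/diff_z]. Qed.

(* The cocycle [z t], seen as [0] outside its own bidegree. *)
Definition part (hq' : int * int) (t : T) : cocycle w hq' :=
  if hq t == hq' then insubd 0 (z t) else 0.

Lemma val_part hq' t : val (part hq' t) = if hq t == hq' then z t else 0.
Proof.
rewrite /part; case: eqP => [<-|_]; last by rewrite raddf0.
by rewrite insubdK //; exact: z_cocycle.
Qed.

Definition torsion_cocycle (B : {set T}) hq' : cocycle w hq' :=
  \sum_(t in B) part hq' t.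

Definition torsion_class (B : {set T}) : Kh w :=
  [ffun i : seq_sub (codom (@bidegree b w)) =>
     \pi_(Kh_at w (val i)) (torsion_cocycle B (val i)) : Kh_at w (val i)].

Lemma val_torsion_cocycle B hq' :
  val (torsion_cocycle B hq') = \sum_(t in B | hq t == hq') z t.
Proof.
rewrite raddf_sum big_mkcondr; apply: eq_bigr => t _; exact: val_part.
Qed.

Lemma phiN t x : phi t (- x) = - phi t x.
Proof. by apply/eqP; rewrite -addr_eq0 -phiD addNr phi0. Qed.

Lemma phi_torsion_cocycle t B :
  (2 %| phi t (val (torsion_cocycle B (hq t))))%Z = (t \notin B).
Proof.
have phi_sum (Q : pred T) (F : T -> chain w) :
    phi t (\sum_(u | Q u) F u) = \sum_(u | Q u) phi t (F u).
  exact: (big_morph _ (@phiD t) (phi0 t)).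
rewrite val_torsion_cocycle phi_sum.
have ev (Q : pred T) : (forall u, Q u -> u != t) ->
    (2 %| \sum_(u | Q u) phi t (z u))%Z.
  by move=> h; apply: rpred_sum => u /h; rewrite /= phi_z eq_sym.
have [tB|tB] := boolP (t \in B); last first.
  by apply: ev => u /andP[uB _]; apply: contraNneq tB => <-.
rewrite (bigD1 t) ?tB ?eqxx //= rpredDr ?phi_z ?eqxx //.
by apply: ev => u /andP[].
Qed.

(** Membership of [t] in [B] is read off from the parity of [phi t]: equal classes differ in
    bidegree [hq t] by a coboundary, on which [phi t] is even. *)
Lemma torsion_class_inj : injective torsion_class.
Proof.
move=> B B' /ffunP e; apply/setP=> t.
have := e (SeqSub (hq_codom t)); rewrite !ffunE /= => /eqP.
rewrite -Quotient.idealrBE => /asboolP[x _].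
rewrite -[cocycle_val _]/(val _) raddfB => dx; have := phi_diff t x.
rewrite dx phiD phiN; have := phi_torsion_cocycle t B.
have := phi_torsion_cocycle t B'; case: (t \in B); case: (t \in B') => //= h' h.
  by rewrite rpredDr ?rpredN ?h.
by rewrite rpredDl ?h // rpredN h'.
Qed.

Lemma torsion_class0 : torsion_class set0 = 0.
Proof.
apply/ffunP=> i; rewrite !ffunE /torsion_cocycle big_set0.
exact: raddf0.
Qed.

Lemma torsion_class_double B : torsion_class B *+ 2 = 0.
Proof.
apply/ffunP=> i; rewrite mulr2n !ffunE -raddfD /=.
rewrite -[RHS](raddf0 \pi_(Kh_at w (val i))).
apply/eqP; rewrite -Quotient.idealrBE subr0; apply/asboolP.
exists (\sum_(t in B | hq t == val i) c t).
  apply: (big_ind (fun x => x \in homogeneous ((val i).1 - 1, (val i).2))).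
  - by have [] := homogeneous_zmod_closed w ((val i).1 - 1, (val i).2).
  - move=> x y hx hy.
    have [h0 hB] := homogeneous_zmod_closed w ((val i).1 - 1, (val i).2).
    by rewrite -[y]opprK -[- y]sub0r; apply: (hB) => //; apply: (hB).
  - by move=> t /andP[_ /eqP <-]; exact: c_hom.
rewrite -[cocycle_val _]/(val _) raddf_sum raddfD /= -[cocycle_val _]/(val _)
  val_torsion_cocycle -big_split; apply: eq_bigr => t _.
by rewrite /= diff_c mulr2n.
Qed.

(** The classes are indexed by the subsets of [T]; the empty one gives 0 and is left out, whence the
    predecessor. *)
Lemma independent_torsion : exists s : seq (Kh w),
  [/\ uniq s, {in s, forall x, order_two x} & size s = (2 ^ #|T|).-1].
Proof.
exists [seq torsion_class B | B <- enum (predC1 (set0 : {set T}))]; split.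
- by rewrite (map_inj_uniq torsion_class_inj) enum_uniq.
- move=> _ /mapP[B Bn0 ->]; rewrite /order_two torsion_class_double eqxx andbT.
  rewrite -torsion_class0 (inj_eq torsion_class_inj).
  by move: Bn0; rewrite mem_enum.
- by rewrite size_map -cardE cardC1 -cardsT -powersetT card_powerset cardsT.
Qed.

End Torsion.

(** * Counting the classes *)

Lemma prod_le_exp (I : finType) (m : I -> nat) (A : pred I) :
  (\prod_(i | A i) m i <= 2 ^ \sum_(i | A i) (m i).-1)%N.
Proof.
rewrite expn_sum; apply: leq_prod => i _.
by case: (m i) => // n; rewrite ltn_expl.
Qed.

Theorem corollary19 (t : nat) (a : 'I_(2 * t) -> int)
    (a_neq0 : forall i, a i != 0)
    (a_neq1 : forall i, a i != 1)
    (a_gt2 : exists j, (2 < a j) && surrounded a j)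
    (a_neg : forall i, a i < 0 -> surrounded a i) :
  exists s : seq (Kh (alternating_word a)),
    [/\ uniq s,
        {in s, forall x, order_two x}
      & \prod_(i | (0 < a i) && surrounded a i) (a i %/ 2)%Z - 1
          <= (size s)%:Z].
Proof.
pose good i := (0 < a i) && surrounded a i.
(* The default 1 leaves no index in [T] for the regions that are not good. *)
pose h i := if good i then `|a i|./2 else 1%N.
pose T : finType := {i : 'I_(2 * t) & 'I_(h i).-1}.
(* For a fixed region this runs through the even numbers from 2 to [a i - 2]. *)
pose deg (x : T) : nat := (2 * (tagged x).+1)%N.
pose P (x : T) := level a (tag x).
pose m (x : T) := `|a (tag x)|%N.
pose g (x : T) : 'I_2 := if odd (tag x) then ord_max else ord0.
pose w := alternating_word a.
(* A state in the support of the cocycle of [x], at which [marked_sum] will test the cocycles. *)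
pose s0 (x : T) := initial_state w (P x) (m x) (deg x).+1.
have goodT (x : T) : good (tag x).
  by case: x => i [r hr]; move: (hr); rewrite /h /=; case: ifP.
have deg_lt (x : T) : ((deg x).+1 < m x)%N.
  case: x (goodT x) => i [r hr] /= gi; rewrite /deg /m /=.
  by move: (hr); rewrite /h gi; lia.
have odd_deg (x : T) : odd (deg x) = false by rewrite /deg oddM.
have deg_gt0 (x : T) : (0 < deg x)%N by rewrite /deg.
have le (x : T) : (P x + m x <= size w)%N by exact: region_le.
have s0_state x : twist_state (P x) (m x) (deg x).+1 (s0 x).
  by apply: twist_initial_state => //; exact/ltnW/deg_lt.
have gen_g x (k : crossing w) : in_twist (P x) (m x) k ->
  gen k = g x by exact: (@region_gen t a (tag x)).
have pos x (k : crossing w) : in_twist (P x) (m x) k -> positive k.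
  by move=> /(@region_positive t a (tag x)) ->; case/andP: (goodT x).
have spl x : forall (s : state w) (k : crossing w),
  full_outside (P x) (m x) s ->
    (0 < twist_ones (P x) (m x) s)%N -> in_twist (P x) (m x) k -> ~~ s k ->
    connect (arc s) (bottom_left k) (top_right k).
  by have /andP[ax _] := goodT x => s k; exact: region_split.
have ends x (s : state w) : full_outside (P x) (m x) s ->
  (0 < twist_ones (P x) (m x) s)%N ->
    connect (arc s) (pt w (P x) (g x)) (pt w (P x + m x) (g x)).
  by have /andP[ax sx] := goodT x; exact: region_ends.
have [|||||||||s [us os es]] := @independent_torsion 2 w T
  (fun x => mark_chain w (P x) (m x) (g x) (deg x).+1)
  (fun x => plus_chain w (P x) (m x) (deg x))
  (fun x => ((twist_bidegree w (m x) (deg x)).1 + 1,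
    (twist_bidegree w (m x) (deg x)).2))
  (fun x => marked_sum (s0 x)).
(* The bidegree of a once-marked state does not depend on the position of its v_-, so any point will
   do. *)
- move=> x; rewrite -(bidegree_mark (le x) (spl x) (pt w 0 0) (deg_gt0 x)
  (s0_state x)).
  exact: codom_f.
- by move=> x; exact: homogeneous_mark_chain (le x) (spl x) _ (deg_gt0 x).
- move=> x; apply: (diff_mark_chain_odd (le x) (gen_g x) (pos x) (spl x) (ends
  x)).
  by rewrite oddS odd_deg.
- move=> x; have := homogeneous_plus_chain (le x) (spl x) (deg_gt0 x).
  by case: twist_bidegree => u v /=; rewrite addrK.
- move=> x; apply: (diff_plus_chain_even (le x) (gen_g x) (pos x) (spl x) (ends
  x)).
    exact: deg_gt0.
  by rewrite odd_deg.
- by move=> x; exact: marked_sum0.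
- by move=> x; exact: marked_sumD.
- move=> x c; apply: marked_sum_diff; have /andP[ax sx] := goodT x.
  by apply: (region_split_below a_neq0 ax sx a_neq1 a_neg _ (s0_state x)).
- move=> x y; rewrite marked_sum_mark_chain (_ : twist_state _ _ _ _ = (x ==
  y)).
    by rewrite -signr_odd; case: eqP; case: odd.
  apply/idP/eqP => [xy|<-]; last exact: s0_state.
  (* The last crossing of the region of [x] is 0 in [s0 x], because [deg x + 1] is less than the
     length of the region, whereas the states for [y] have zeros only in the region of [y]. *)
  have tag_xy : tag x = tag y.
    have [k rk ek] := last_crossing a_neq0 (tag x).
    apply: (region_inj rk); have [fs _] := twist_stateP _ _ _ _ xy.
    apply: contraT => /fs; rewrite ffunE -/(region _ _) rk /=.
    move: ek (deg_lt x); rewrite levelS -/(P x) -/(m x).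
    by move: (P x) (m x) (deg x) (nat_of_ord k) => u v d l; lia.
  have [_ e1] := twist_stateP _ _ _ _ (s0_state x).
  have [_] := twist_stateP _ _ _ _ xy.
  rewrite {1}/P {1}/m -tag_xy e1 /deg; move: tag_xy.
  case: x y {xy e1} => [i r] [j r'] /= e; subst j => -[er].
  by congr existT; apply: val_inj => /=; lia.
exists s; split=> //; rewrite es.
have -> : #|T| = (\sum_(i | good i) (h i).-1)%N.
  rewrite card_tagged sumnE big_map big_enum /= [RHS]big_mkcond.
  by apply: eq_bigr => i _; rewrite card_ord /h; case: ifP.
rewrite (eq_bigr (fun i => (h i)%:Z)) => [|i gi]; last first.
  by rewrite /h /good gi; case/andP: gi => ai _; lia.
rewrite -(big_morph Posz PoszM (erefl 1%:Z)).
have := prod_le_exp h good; move: (\prod_(i | _) _)%N (\sum_(i | _) _)%N => u v.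
by lia.
Qed.
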